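(* Let $\Delta=[-\frac{\pi}{2},\frac{\pi}{2}]$. The space $H^1_0(\Delta)$ equipped with the inner product $\langle\cdot,\cdot\rangle_i$ (and norm $\|f\|_i=\langle f,f\rangle_i^{1/2}$) is a reproducing kernel Hilbert space, i.e. it is complete, all point evaluations $f\mapsto f(x)$, $x\in\Delta$, are bounded linear functionals, and its reproducing kernel is $$K_i(x,y)=2-\frac{\pi}{2}\sin|x-y|,\qquad x,y\in\Delta.$$
   Context: $H^1(\Delta)$ denotes the space of absolutely continuous functions $f:\Delta\to\mathbb{R}$ whose (a.e. defined) derivative $f'$ lies in $L_2(\Delta)$. $H^1_0(\Delta)$ is the subspace of those $f\in H^1(\Delta)$ with $f(-\frac{\pi}{2})=f(\frac{\pi}{2})$. For $f,g\in H^1_0(\Delta)$, $$\langle f,g\rangle_i=\frac{1}{\pi^2}\Big[2\Big(\int_{-\pi/2}^{\pi/2}f\Big)\Big(\int_{-\pi/2}^{\pi/2}g\Big)-\pi\int_{-\pi/2}^{\pi/2}\big(fg-f'g'\big)\Big],$$ which is a positive definite inner product on $H^1_0(\Delta)$. *)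

(* Defs.v *)
From HB Require Import structures.
From mathcomp Require Import all_boot all_order all_algebra.
From mathcomp Require Import all_classical all_reals all_analysis.
Set Implicit Arguments. Unset Strict Implicit. Unset Printing Implicit Defensive.
Import Order.TTheory GRing.Theory Num.Theory numFieldNormedType.Exports.
Local Open Scope classical_set_scope.
Local Open Scope ring_scope.

Section H1Defs.
Variable R : realType.

Definition Delta : set R := `[- (pi / 2), pi / 2]%classic.

Definition abs_continuous_on (a b : R) (f : R -> R) : Prop :=
  forall eps : R, 0 < eps -> exists2 delta : R, 0 < delta &
    forall (n : nat) (s t : 'I_n -> R),
      (forall i, a <= s i /\ s i <= t i /\ t i <= b) ->
      (forall i j : 'I_n, (i < j)%N -> t i <= s j) ->
      \sum_(i < n) (t i - s i) < delta ->
      \sum_(i < n) `|f (t i) - f (s i)| < eps.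

(* H^1(Delta): absolutely continuous functions whose (a.e. defined)
   derivative lies in L_2(Delta).  The derivative is MathComp-Analysis's
   derive1, which coincides with the a.e. derivative wherever the latter
   exists. *)
Definition H1 (f : R -> R) : Prop :=
  [/\ abs_continuous_on (- (pi / 2)) (pi / 2) f,
      measurable_fun Delta (derive1 f) &
      (@lebesgue_measure R).-integrable Delta
         (fun x => ((derive1 f x) ^+ 2)%:E)].

Definition H10 (f : R -> R) : Prop := H1 f /\ f (- (pi / 2)) = f (pi / 2).

Definition intD (f : R -> R) : R := \int[@lebesgue_measure R]_(x in Delta) f x.

Definition ip_i (f g : R -> R) : R :=
  (pi ^+ 2)^-1 * (2 * (intD f * intD g)
                  - pi * intD (fun x => f x * g x - derive1 f x * derive1 g x)).

Definition norm_i (f : R -> R) : R := Num.sqrt (ip_i f f).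

Definition K_i (x y : R) : R := 2 - pi / 2 * sin `|x - y|.

End H1Defs.

(* Main.v *)
(** An absolutely continuous [f] is the integral of its a.e. derivative: its
    variation function is absolutely continuous and nondecreasing, so that the
    associated Lebesgue-Stieltjes measure is dominated by Lebesgue measure, and
    the Radon-Nikodym and Lebesgue differentiation theorems apply. This makes
    integration by parts available on the space.

    Pairing [f'] with a mean-zero sawtooth [s_x] of squared norm [pi^3/12]
    yields [pi f(x) - \int f], hence [(pi f(x) - \int f)^2 <= pi^3/12 \int f'^2].
    Integrating in [x] gives
    [pi^2 <f,f>_i >= (\int f)^2 + pi (1 - pi^2/12) \int f'^2], and [pi^2 < 12]:
    the norm dominates both the [H^1] norm and the point evaluations.
    Completeness then reduces to that of [L_2] applied to the derivatives. The
    reproducing identity is an integration by parts on each side of [x], where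
    the jump of [K_i(x, .)'] at [x] produces [pi f(x)]. *)
Require Import Defs.
From HB Require Import structures.
From mathcomp Require Import all_boot all_order all_algebra.
From mathcomp Require Import all_classical all_reals all_analysis.
From mathcomp Require Import measurable_realfun ring lra.
Import Order.TTheory GRing.Theory Num.Theory numFieldNormedType.Exports.
Local Open Scope classical_set_scope.
Local Open Scope ring_scope.
Set Implicit Arguments. Unset Strict Implicit. Unset Printing Implicit Defensive.

(** * Absolutely continuous functions have absolutely continuous variation *)

(** The derivative term has to absorb [- pi \int f^2], and crude estimates fail. The ramps [y - a]
    left of [x] and [y - b] right of [x], with [a], [b] the endpoints, already pair with [f'] to
    [pi f(x) - \int f], but their squared norm averages [pi^3/6] over [x], and [pi^2/6 > 1]. Since
    [f'] has mean zero on the space, a constant may be subtracted; removing the mean halves this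
    average to [pi^3/12], which suffices without the sharp Wirtinger constant. The other obstacle is
    that elements of the space are functions on the whole line, arbitrary outside [Delta], and that
    [derive1] is total, with a default value where no derivative exists. Membership thus asks for
    measurability of a concrete function rather than of a class modulo null sets, and [derive1] is
    known to respect differences only almost everywhere. Hence the clamped extensions, the Borel
    measurability of derivatives, and the repeated transfers along almost-everywhere equalities. *)

Section AbsoluteContinuity.
Context {R : realType}.
Implicit Types (a b c : R) (f F : R -> R) (L : seq (R * R)).

(* A pair [p] stands for the interval [p.2, p.1], the order produced by
   [variation_zip]. *)
Fixpoint chain c L b : bool :=
  if L is p :: L' then [&& c <= p.2, p.2 <= p.1 & chain p.1 L' b] else c <= b.

Definition chain_length L : R := \sum_(p <- L) (p.1 - p.2).

Definition chain_variation f L : R := \sum_(p <- L) `|f p.1 - f p.2|.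

(** Lists replace the families indexed by ['I_n] of [abs_continuous_on], so that intervals can be
    refined by concatenation and handled by induction; [abs_continuous_onW] and
    [abs_continuous_chainW] translate. *)
Definition abs_continuous_chain a b f := forall eps : R, 0 < eps ->
  exists2 delta : R, 0 < delta & forall L, chain a L b ->
    chain_length L < delta -> chain_variation f L < eps.

Lemma chain_le c L b : chain c L b -> c <= b.
Proof.
elim: L c => [//|p L IH] c /= /and3P[cp pp /IH]; lra.
Qed.

Lemma chain_all c L b : chain c L b ->
  all (fun p => [&& c <= p.2, p.2 <= p.1 & p.1 <= b]) L.
Proof.
elim: L c => [//|p L IH] c /= /and3P[cp pp pL].
rewrite cp pp (chain_le pL) /=; move: (IH _ pL); apply: sub_all => q.
by move=> /and3P[pq -> ->]; rewrite !andbT; lra.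
Qed.

Lemma chain_cat a L1 c L2 b :
  chain a L1 c -> chain c L2 b -> chain a (L1 ++ L2) b.
Proof.
elim: L1 a => [|p L1 IH] a /=; last first.
  by move=> /and3P[-> -> /IH]; exact.
case: L2 => [|q L2] /=; first exact: le_trans.
by move=> ac /and3P[cq -> ->]; rewrite (le_trans ac cq).
Qed.

Lemma chain_length_cat L1 L2 :
  chain_length (L1 ++ L2) = chain_length L1 + chain_length L2.
Proof. by rewrite /chain_length big_cat. Qed.

Lemma chain_variation_cat f L1 L2 : chain_variation f (L1 ++ L2) =
  chain_variation f L1 + chain_variation f L2.
Proof. by rewrite /chain_variation big_cat. Qed.

Lemma chain_zip c s b : itv_partition c b s -> chain c (zip s (c :: s)) b.
Proof.
elim: s c => [|x s IH] c; first by move=> /itv_partition_nil -> /=.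
move=> cs; have [/= /andP[cx _] _] := cs.
by move: cs => /itv_partition_cons /IH; rewrite /= lexx (ltW cx).
Qed.

Lemma chain_length_zip c s b : itv_partition c b s ->
  chain_length (zip s (c :: s)) = b - c.
Proof.
rewrite /chain_length; elim: s c => [|x s IH] c.
  by move=> /itv_partition_nil -> /=; rewrite big_nil subrr.
by move=> /itv_partition_cons /IH; rewrite /= big_cons /= => ->; ring.
Qed.

Lemma chain_nth c L b i : chain c L b -> (i < size L)%N ->
  [/\ c <= (nth (b, b) L i).2, (nth (b, b) L i).2 <= (nth (b, b) L i).1
    & (nth (b, b) L i).1 <= b].
Proof.
elim: L c i => [//|p L IH] c [|i] /= /and3P[cp pp cL]; last first.
  by rewrite ltnS => /(IH _ _ cL)[? ? ?]; split=> //; lra.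
by move=> _; split=> //; exact: chain_le cL.
Qed.

Lemma chain_nth_lt c L b i j : chain c L b -> (i < j)%N -> (j < size L)%N ->
  (nth (b, b) L i).1 <= (nth (b, b) L j).2.
Proof.
elim: L c i j => [//|p L IH] c i [//|j] /= /and3P[cp pp cL]; case: i => [|i] /=.
  by rewrite ltnS => _ /(chain_nth cL)[].
by rewrite !ltnS; exact: IH cL.
Qed.

Lemma abs_continuous_onW a b f :
  abs_continuous_on a b f -> abs_continuous_chain a b f.
Proof.
move=> acf e e0; have [d d0 H] := acf e e0; exists d => // L cL.
rewrite /chain_length /chain_variation !(big_nth (b, b)) !big_mkord => Ld.
apply: (H (size L) (fun i => (nth (b, b) L i).2) (fun i => (nth (b, b) L i).1)) => //.
  by move=> i; have [] := chain_nth cL (ltn_ord i).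
by move=> i j ij; exact: chain_nth_lt cL ij (ltn_ord j).
Qed.

(* The intervals of [L] are traded one by one for fine partitions, collected
   in [L0]. *)
Lemma chain_total_variation a b f (eps delta : R) :
  (forall L, chain a L b -> chain_length L < delta ->
     chain_variation f L <= eps) ->
  forall L L0 c, chain a L0 c -> chain c L b ->
    chain_length L0 + chain_length L < delta ->
    ((chain_variation f L0)%:E + \sum_(p <- L) total_variation p.2 p.1 f
       <= eps%:E)%E.
Proof.
move=> H; elim=> [|p L IH] L0 c aL0 /=.
  rewrite /chain_length !big_nil addr0 adde0 => cb Ld; rewrite lee_fin H//.
  by have := chain_cat aL0 (L2 := [::]) cb; rewrite cats0.
move=> /and3P[cp pp pL]; rewrite {2}/chain_length !big_cons => Ld.
have aL0p : chain a L0 p.1.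
  have := @chain_cat a L0 c [::] p.1 aL0; rewrite cats0; apply => /=; lra.
have WL := IH L0 p.1 aL0p pL.
have {}WL : ((chain_variation f L0)%:E + \sum_(p <- L) total_variation p.2 p.1 f
       <= eps%:E)%E.
  by apply: WL; move: Ld; rewrite /chain_length; lra.
have W0 : (0 <= \sum_(p <- L) total_variation p.2 p.1 f)%E.
  have := chain_all pL.
  elim: (L) => [|q M IHM]/=; first by rewrite big_nil.
  by move=> /andP[/and3P[_ qq _] /IHM M0]; rewrite big_cons adde_ge0// total_variation_ge0.
have Wfin : (\sum_(p <- L) total_variation p.2 p.1 f)%E \is a fin_num.
  rewrite ge0_fin_numE//; apply: (@le_lt_trans _ _ (eps - chain_variation f L0)%:E);
    last exact: ltry.
  by rewrite EFinB leeBrDl.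
rewrite -(fineK Wfin) in WL *.
set w := fine _ in WL *.
(* The remaining sum is now known to be finite and can change sides. What is left is a bound uniform
   in the partition [s] of the interval [p]; appending [s] to [L0] keeps the total length, so the
   induction hypothesis applies. *)
suff : (total_variation p.2 p.1 f <= (eps - chain_variation f L0 - w)%:E)%E.
  move=> /(leeD2r w%:E) /(leeD2l (chain_variation f L0)%:E) /le_trans; apply.
  by rewrite -!EFinD lee_fin; lra.
apply: ge_ereal_sup => _ [_ [s ps <-] <-].
have := IH (L0 ++ zip s (p.2 :: s)) p.1.
rewrite -(fineK Wfin) -/w -EFinD !lee_fin => IHs.
have -> : variation p.2 p.1 f s = chain_variation f (zip s (p.2 :: s)).
  exact: variation_zip.
have aL0p2 : chain a L0 p.2.
  have := @chain_cat a L0 c [::] p.2 aL0; rewrite cats0; exact.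
have := IHs (chain_cat aL0p2 (chain_zip ps)) pL.
rewrite chain_length_cat chain_variation_cat (chain_length_zip ps).
set v := chain_variation f (zip _ _) => K.
have {K} : chain_variation f L0 + v + w <= eps.
  by apply: K; move: Ld; rewrite -/(chain_length L); lra.
lra.
Qed.

(** For [eps = 1], the variation over any interval shorter than [d] is at most 1; finitely many
    steps of length [d / 2] cover [[a, b]], and variation is additive. *)
Lemma abs_continuous_bounded_variation a b f : a <= b ->
  abs_continuous_chain a b f -> bounded_variation a b f.
Proof.
move=> ab acf; apply/bounded_variationP => //.
have [d d0 H] := acf 1 ltr01.
have {}H L (aL : chain a L b) (Ld : chain_length L < d) := ltW (H L aL Ld).
have step c e : a <= c -> c <= e -> e <= b -> e - c < d ->
    total_variation c e f \is a fin_num.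
  move=> ac ce eb ecd.
  have := @chain_total_variation a b f 1 d H [:: (e, c)] [::] c ac.
  rewrite /= lexx ce eb /chain_length /chain_variation !big_cons !big_nil.
  rewrite !add0r !addr0 => /(_ isT ecd) TV1.
  rewrite ge0_fin_numE ?total_variation_ge0//.
  exact: le_lt_trans TV1 (ltry _).
have all_k (k : nat) :
    total_variation a (Num.min b (a + k%:R * (d / 2))) f \is a fin_num.
  elim: k => [|k IH].
    by rewrite mul0r addr0 min_r// total_variationxx.
  set c := Num.min _ _ in IH; set e := Num.min _ _.
  have ac : a <= c.
    by rewrite le_min ab/= lerDl mulr_ge0//; lra.
  have kk : a + k.+1%:R * (d / 2) = a + k%:R * (d/2) + d/2.
    by rewrite -natr1; ring.
  have ce : c <= e by rewrite /c /e kk; have [?|?] := leP b (a + k%:R * (d / 2));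
    have [?|?] := leP b (a + k%:R * (d / 2) + d / 2); lra.
  have eb : e <= b by rewrite ge_min lexx.
  rewrite (total_variationD f ac ce) fin_numD IH step//.
  by move: ac ce; rewrite /c /e kk; have [?|?] := leP b (a + k%:R * (d / 2));
    have [?|?] := leP b (a + k%:R * (d / 2) + d / 2); lra.
have [k kb] : exists k : nat, b <= a + k%:R * (d / 2).
  exists (Num.bound ((b - a) / (d / 2))).
  have : (b - a) / (d / 2) < (Num.bound ((b - a) / (d / 2)))%:R.
    by apply: archi_boundP; rewrite divr_ge0//; lra.
  by rewrite ltr_pdivrMr; lra.
by have := all_k k; rewrite min_l.
Qed.

Lemma abs_continuous_total_variation a b f : a <= b ->
  abs_continuous_chain a b f ->
  abs_continuous_chain a b (fun x => fine (total_variation a x f)).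
Proof.
move=> ab acf e e0.
have bv := abs_continuous_bounded_variation ab acf.
(* Halving restores the strict inequality, which is lost when passing to suprema over partitions. *)
have e2 : 0 < e / 2 by lra.
have [d d0 H] := acf _ e2.
have {}H L (aL : chain a L b) (Ld : chain_length L < d) := ltW (H L aL Ld).
exists d => // L aL Ld.
have := @chain_total_variation a b f (e/2) d H L [::] a (lexx _) aL.
rewrite /chain_variation /chain_length !big_nil add0r add0e => /(_ Ld) TVe.
suff : ((\sum_(p <- L) `|fine (total_variation a p.1 f)
          - fine (total_variation a p.2 f)|)%:E <= (e/2)%:E)%E.
  by rewrite lee_fin; lra.
apply: le_trans TVe.
have := chain_all aL.
elim: (L) => [|q M IHM]/=; first by rewrite !big_nil.
move=> /andP[/and3P[aq qq qb] /IHM {}IHM]; rewrite !big_cons EFinD leeD//.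
have fina x : a <= x -> x <= b -> total_variation a x f \is a fin_num.
  by move=> ax xb; apply/bounded_variationP => //; exact: bounded_variationl bv.
have a1 : a <= q.1 by rewrite (le_trans aq).
have b2 : q.2 <= b by rewrite (le_trans qq).
rewrite (total_variationD f aq qq) fineD ?fina//; last first.
  apply/bounded_variationP => //; apply: (bounded_variationl qq qb).
  exact: bounded_variationr bv.
rewrite addrAC subrr add0r ger0_norm ?fine_ge0 ?total_variation_ge0//.
rewrite fineK//; apply/bounded_variationP => //.
by apply: (bounded_variationl qq qb); exact: bounded_variationr bv.
Qed.

Lemma abs_continuous_chainB a b f F : abs_continuous_chain a b f ->
  abs_continuous_chain a b F -> abs_continuous_chain a b (fun x => f x - F x).
Proof.
move=> acf acF e e0; have e2 : 0 < e / 2 by lra.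
have [d d0 Hf] := acf _ e2; have [d' d'0 HF] := acF _ e2.
exists (Num.min d d'); first by rewrite lt_min d0.
move=> L aL; rewrite lt_min => /andP[/(Hf _ aL) fL /(HF _ aL) FL].
apply: (@le_lt_trans _ _ (chain_variation f L + chain_variation F L)).
  rewrite /chain_variation -big_split/=; apply: ler_sum => p _.
  by have := ler_normB (f p.1 - f p.2) (F p.1 - F p.2);
    rewrite (_ : _ - _ - (_ - _) = f p.1 - F p.1 - (f p.2 - F p.2)); [|ring].
lra.
Qed.

Lemma abs_continuous_chain_dist a b f (e : R) : abs_continuous_chain a b f ->
  0 < e -> exists2 d, 0 < d & forall x y, a <= x -> x <= b -> a <= y ->
    y <= b -> `|x - y| < d -> `|f x - f y| < e.
Proof.
move=> acf e0; have [d d0 H] := acf _ e0; exists d => // x y.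
wlog xy : x y / y <= x.
  move=> W ax xb ay yb; have [yx|/ltW xy] := leP y x; first exact: W.
  by rewrite distrC [in X in _ -> X]distrC; exact: W.
move=> ax xb ay yb; rewrite ger0_norm ?subr_ge0// => xyd.
have := H [:: (x, y)]; rewrite /chain_length /chain_variation !big_cons !big_nil.
by rewrite /= ay xy xb !addr0; exact.
Qed.

End AbsoluteContinuity.
(** * Lebesgue-Stieltjes measures of absolutely continuous functions *)

Section LebesgueStieltjes.
Context {R : realType}.
Implicit Types (a b c : R) (f F : R -> R) (L : seq (R * R)).
Local Notation mu := (@lebesgue_measure R).

(** Left-open intervals stay disjoint when consecutive ones share an endpoint, and a Stieltjes
    measure assigns them increments. *)
Definition chain_set L : set R := \big[setU/set0]_(p <- L) `]p.2, p.1]%classic.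

Lemma chain_set_subset c L b : chain c L b -> chain_set L `<=` `]c, b]%classic.
Proof.
rewrite /chain_set; elim: L c => [|p L IH] c /=.
  by rewrite big_nil => _; exact: sub0set.
move=> /and3P[cp pp pL]; rewrite big_cons => x [|/(IH _ pL)] /=; rewrite !in_itv/=.
  by have := chain_le pL => ? ?; lra.
by move=> ?; lra.
Qed.

Lemma measurable_chain_set L : measurable (chain_set L).
Proof. exact: bigsetU_measurable. Qed.

Lemma measure_chain_set (m : {measure set (measurableTypeR R) -> \bar R})
    F a b L : chain a L b ->
  (forall x y, a <= x -> x <= y -> y <= b -> m `]x, y]%classic = (F y - F x)%:E) ->
  m (chain_set L) = (\sum_(p <- L) (F p.1 - F p.2))%:E.
Proof.
move=> + mF; elim: L a mF => [|p L IH] a mF aL.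
  by rewrite /chain_set !big_nil measure0.
have /= /and3P[ap pp pL] := aL.
rewrite /chain_set !big_cons -/(chain_set L) measureU/=.
- rewrite EFinD mF//; last exact: chain_le pL.
  by rewrite (IH p.1)// => x y px; apply: mF; rewrite (le_trans ap)// (le_trans pp).
- exact: measurable_itv.
- exact: measurable_chain_set.
- rewrite -subset0 => x [/= + /(chain_set_subset pL)/=].
  by rewrite !in_itv/=; lra.
Qed.

Lemma chain_iota (c : nat -> R) (P : pred nat) m j :
  (forall k, c k <= c k.+1) ->
  chain (c m) [seq (c k.+1, c k) | k <- iota m j & P k] (c (m + j)%N).
Proof.
move=> cS; elim: j m => [|j IH] m /=; first by rewrite addn0.
rewrite addnS -addSn; case: ifP => _ /=; first by rewrite lexx cS IH.
exact: (@chain_cat _ (c m) [::] (c m.+1) _ _ (cS m) (IH _)).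
Qed.

(** Outer regularity encloses [A] in an open [U] of Lebesgue measure below [d]. Instead of splitting
    [U] into components, it is filled with the cells of a regular grid that it contains: these form
    a finite chain of length below [d], hence of [nu]-measure at most [e], and every point of [A]
    lies in such a cell once the grid is fine enough. *)
Lemma null_dominates_abs_continuous
    (nu : {measure set (measurableTypeR R) -> \bar R}) F a b : a < b ->
  (forall x y, a <= x -> x <= y -> y <= b -> nu `]x, y]%classic = (F y - F x)%:E) ->
  abs_continuous_chain a b F ->
  forall A : set R, measurable A -> A `<=` `]a, b]%classic -> mu A = 0%E ->
  nu A = 0%E.
Proof.
move=> ab nuF acF A mA Aab muA.
apply/eqP; rewrite eq_le measure_ge0 andbT.
apply/lee_addgt0Pr => e e0; rewrite add0e.
have [d d0 H] := acF _ e0.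
have muAoo : (mu A < +oo)%E by rewrite muA ltry.
have [U [oU AU UA]] := lebesgue_regularity_outer mA muAoo d0.
have mU : measurable U := open_measurable oU.
have Ud : (mu U < d%:E)%E.
  rewrite -(setDUK AU) measureU//; last 2 first.
  - exact: measurableD.
  - by rewrite setDIK.
  by move: UA; rewrite -[X in (X < _)%E -> _]add0e -[X in (X + _ < _)%E -> _]muA.
pose h n : R := (b - a) / n.+1%:R.
have h0 n : 0 < h n by rewrite divr_gt0// subr_gt0.
pose c n (k : nat) : R := a + k%:R * h n.
have cS n k : c n k.+1 = c n k + h n by rewrite /c -natr1; ring.
have c0 n : c n 0%N = a by rewrite /c mul0r addr0.
have cn n : c n n.+1 = b.
  by rewrite /c /h mulrC divfK ?pnatr_eq0// addrC subrK.
pose P n k := `[< `]c n k, c n k.+1]%classic `<=` U >].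
pose L n := [seq (c n k.+1, c n k) | k <- iota 0 n.+1 & P n k].
have aL n : chain a (L n) b.
  have := @chain_iota (c n) (P n) 0 n.+1.
  rewrite add0n cn c0; apply => k.
  by rewrite cS lerDl ltW.
have LU n : chain_set (L n) `<=` U.
  rewrite /chain_set /L big_map big_filter.
  apply: (@big_ind _ (fun X => X `<=` U)); first exact: sub0set.
    by move=> X Y XU YU; rewrite subUset.
  by move=> k /asboolP.
have nuL n : (nu (chain_set (L n)) <= e%:E)%E.
  rewrite (measure_chain_set (aL n) nuF) lee_fin ltW//.
  apply: (@le_lt_trans _ _ (chain_variation F (L n))).
    by apply: ler_sum => p _; exact: ler_norm.
  apply: H (aL n) _; rewrite -lte_fin.
  rewrite -(@measure_chain_set (@lebesgue_measure R) idfun a b)//; last first.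
    move=> x y _ xy _; apply: (etrans (lebesgue_measure_itv `]x, y])).
    by rewrite /= lte_fin; case: ltgtP xy => // -> _; rewrite subrr.
  apply: le_lt_trans Ud; apply: (le_measure mu); rewrite ?inE//.
  exact: measurable_chain_set.
(* The grids do not refine one another, so the sets [chain_set (L n)] need not increase. Their tail
   intersections do, and continuity from below applies to these. *)
pose W n := \bigcap_(m in [set m | (n <= m)%N]) chain_set (L m).
have mW n : measurable (W n).
  apply: bigcap_measurable => [|m _]; first by exists n => /=.
  exact: measurable_chain_set.
have AW : A `<=` \bigcup_n W n.
  move=> x Ax; have [r /= r0 rU] := (nbhs_ballP _ _).1 (oU _ (AU _ Ax)).
  have [N Nr] : exists N : nat, (b - a) / r < N%:R.
    by exists (Num.bound ((b - a) / r)); apply: archi_boundP; rewrite divr_ge0//; lra.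
  exists N => // n /= Nn.
  have hr : h n < r.
    rewrite /h ltr_pdivrMr// mulrC -ltr_pdivrMr//; apply: (lt_trans Nr).
    by rewrite ltr_nat.
  have := Aab _ Ax; rewrite /= in_itv/= => /andP[ax xb].
  have exk : exists k, x <= c n k by exists n.+1; rewrite cn.
  (* The least grid point at or above [x] closes the left-open cell containing [x]; index 0 is
     excluded by [a < x]. *)
  case: (ex_minnP exk) => -[|k] xk mink.
    by move: xk; rewrite c0; lra.
  have kx : c n k < x.
    by rewrite ltNge; apply/negP => /mink; rewrite ltnn.
  have kn : (k < n.+1)%N by apply: mink; rewrite cn.
  have Pk : P n k.
    apply/asboolP => y /=; rewrite in_itv/= => /andP[ky yk]; apply: rU => /=.
    rewrite /ball/= ltr_distlC.
    by move: xk yk; rewrite cS => xk yk; lra.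
  suff : (c n k.+1, c n k) \in L n.
    move=> kL; rewrite /chain_set (perm_big _ (perm_to_rem kL)) big_cons; left.
    by rewrite /= in_itv/= kx.
  by apply/mapP; exists k => //; rewrite mem_filter Pk mem_iota.
have mbigW : measurable (\bigcup_n W n) by exact: bigcupT_measurable.
have nuW n : (nu (W n) <= e%:E)%E.
  apply: le_trans (nuL n).
  have mL := measurable_chain_set (L n).
  apply: (le_measure nu); [exact: mem_set (mW n)|exact: mem_set mL|].
  by move=> x Wx; exact: (Wx n (leqnn n)).
have cvW : nu (W n) @[n --> \oo] --> nu (\bigcup_n W n).
  apply: nondecreasing_cvg_mu => //.
  move=> n m nm; apply/subsetPset => x Wx k /= mk; apply: Wx => /=.
  exact: leq_trans mk.
apply: (@le_trans _ _ (nu (\bigcup_n W n))).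
  by apply: (le_measure nu); rewrite ?inE.
rewrite -(cvg_lim _ cvW)//; apply: lime_le; first by apply/cvg_ex; eexists; exact: cvW.
by apply: nearW => n; exact: nuW.
Qed.

(** Precomposing with this retraction onto [[a, b]] extends a function by constants, making it
    globally continuous or monotone without changing it on the interval. *)
Definition clamp a b (x : R) : R := Num.max a (Num.min x b).

Lemma clamp_id a b x : a <= x -> x <= b -> clamp a b x = x.
Proof. by move=> ax xb; rewrite /clamp min_l// max_r. Qed.

Lemma clamp_itv a b x : a <= b -> a <= clamp a b x <= b.
Proof.
by move=> ab; rewrite /clamp le_max lexx ge_max ab ge_min lexx orbT.
Qed.

Lemma clamp_dist a b x y : `|clamp a b x - clamp a b y| <= `|x - y|.
Proof.
wlog xy : x y / x <= y.
  move=> W; have [/W//|/ltW/W] := leP x y.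
  by rewrite distrC (distrC y).
have mxy : clamp a b x <= clamp a b y.
  by rewrite /clamp; apply: le_max2 => //; apply: le_min2.
rewrite ler0_norm ?subr_le0// ler0_norm ?subr_le0//.
move: mxy; rewrite /clamp.
have [?|?] := leP x b; have [?|?] := leP y b; rewrite ?le_max;
  have [?|?] := leP a x; have [?|?] := leP a y; have [?|?] := leP a b; lra.
Qed.

Lemma clamp_homo a b : {homo clamp a b : x y / x <= y}.
Proof. by move=> x y xy; apply: le_max2 => //; apply: le_min2. Qed.

Lemma abs_continuous_clamp a b f : a <= b -> abs_continuous_chain a b f ->
  continuous (f \o clamp a b).
Proof.
move=> ab acf x; apply/cvgrPdist_lt => e e0.
have [d d0 H] := abs_continuous_chain_dist acf e0.
near=> y; have /andP[? ?] := clamp_itv x ab; have /andP[? ?] := clamp_itv y ab.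
apply: H => //; apply: le_lt_trans (clamp_dist _ _ _ _) _.
by near: y; exact: cvgr_dist_lt.
Unshelve. all: by end_near. Qed.

Lemma nondecreasing_abs_continuous_integral a b F : a < b ->
  (forall x y, a <= x -> x <= y -> y <= b -> F x <= F y) ->
  abs_continuous_chain a b F ->
  exists2 g : R -> R, mu.-integrable setT (EFin \o g) &
    forall x, a <= x -> x <= b ->
      F x - F a = \int[mu]_(t in `]a, x]) g t.
Proof.
move=> ab ndF acF; have ab' := ltW ab.
pose G : R -> R := F \o clamp a b.
have ndG : nondecreasing_fun G.
  move=> x y xy; have /andP[? ?] := clamp_itv x ab'.
  by have /andP[? ?] := clamp_itv y ab'; apply: ndF => //; exact: clamp_homo.
have rcG : right_continuous G.
  by apply: right_continuousW; exact: abs_continuous_clamp.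
pose Gi := isCumulative.Build R _ R G ndG rcG.
pose Gc : cumulative R R := HB.pack G Gi.
pose nu := lebesgue_stieltjes_measure Gc.
have nuE x y : a <= x -> x <= y -> y <= b -> nu `]x, y]%classic = (F y - F x)%:E.
  move=> ax xy yb; rewrite /nu /lebesgue_stieltjes_measure.
  rewrite /measure_extension measurable_mu_extE/=; last exact: is_ocitv.
  by rewrite wlength_itv_bnd//= /G/= !clamp_id// ?(le_trans ax)// (le_trans xy).
have mD : measurable (`]a, b]%classic : set (measurableTypeR R)).
  exact: measurable_itv.
have Dfin : (nu `]a, b]%classic < +oo)%E by rewrite nuE// ltry.
(* Restricting to []a, b]] yields a finite measure and confines null sets to the interval where
   increments of [F] are controlled. *)
pose nuD : {finite_measure set (measurableTypeR R) -> \bar R} := mfrestr mD Dfin.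
have dom : nuD `<< (@lebesgue_measure R).
  apply/null_content_dominatesP => A mA muA.
  apply: (null_dominates_abs_continuous ab nuE acF).
  - exact: measurableI.
  - exact: subIsetr.
  - by apply: (@subset_measure0 _ _ _ _ _ A) => //; exact: measurableI.
have [g [g0 gfin gint gE]] := radon_nikodym_sigma_finite dom.
exists (fine \o g).
  apply: eq_integrable gint => // x _; rewrite /= fineK//.
move=> x ax xb; rewrite /Rintegral.
have := gE `]a, x]%classic (measurable_itv _).
under [in RHS]eq_integral do rewrite -(fineK (gfin _)).
move=> <-.
have -> : nuD `]a, x]%classic = nu (`]a, x]%classic `&` `]a, b]%classic) by [].
rewrite setIidl ?nuE//.
by apply: subset_itvl; rewrite bnd_simp.
Qed.

End LebesgueStieltjes.
(** * Absolutely continuous functions as integrals *)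

Section Representation.
Context {R : realType}.
Implicit Types (a b c : R) (f g F : R -> R).
Local Notation mu := (@lebesgue_measure R).

(** Jordan decomposition: [f = V - (V - f)] with [V] the variation function; both parts are
    nondecreasing and absolutely continuous, so each has a density. *)
Lemma abs_continuous_integral a b f : a < b -> abs_continuous_chain a b f ->
  exists2 g : R -> R, mu.-integrable setT (EFin \o g) &
    forall x, a <= x -> x <= b -> f x - f a = \int[mu]_(t in `]a, x]) g t.
Proof.
move=> ab acf; have ab' := ltW ab.
pose V x := fine (total_variation a x f).
have acV : abs_continuous_chain a b V := abs_continuous_total_variation ab' acf.
have bv := abs_continuous_bounded_variation ab' acf.
have fin x y : a <= x -> x <= y -> y <= b -> total_variation x y f \is a fin_num.
  move=> ax xy yb; apply/bounded_variationP => //.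
  apply: (bounded_variationl xy yb); apply: bounded_variationr bv => //.
  exact: le_trans xy yb.
have VD x y : a <= x -> x <= y -> y <= b ->
    V y - V x = fine (total_variation x y f).
  move=> ax xy yb; rewrite /V (total_variationD f ax xy) fineD ?fin//.
    by rewrite addrAC subrr add0r.
  exact: le_trans xy yb.
have ndV x y : a <= x -> x <= y -> y <= b -> V x <= V y.
  move=> ax xy yb; rewrite -subr_ge0 VD// fine_ge0//.
  exact: total_variation_ge0.
have ndN x y : a <= x -> x <= y -> y <= b -> V x - f x <= V y - f y.
  move=> ax xy yb; suff : f y - f x <= V y - V x by lra.
  rewrite VD//; have := total_variation_ge f xy.
  rewrite -[X in (_ <= X)%E](fineK (fin _ _ ax xy yb)) lee_fin; apply: le_trans.
  exact: ler_norm.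
have [gV iV VE] := nondecreasing_abs_continuous_integral ab ndV acV.
have [gN iN NE] := nondecreasing_abs_continuous_integral ab ndN
  (abs_continuous_chainB acV acf).
exists (fun x => gV x - gN x); first exact: (integrableB measurableT iV iN).
move=> x ax xb; rewrite RintegralB//; last 2 first.
  exact: integrableS iV.
  exact: integrableS iN.
by rewrite -VE// -NE//; ring.
Qed.

Lemma near_eq_derive1 (f g : R -> R) (x : R) : {near x, f =1 g} ->
  derive1 f x = derive1 g x.
Proof. by move=> fg; rewrite !derive1E; exact: near_eq_derive. Qed.

Lemma near_itv_oo a b (x : R) (P : R -> Prop) : a < x -> x < b ->
  (forall y, a < y -> y < b -> P y) -> \forall y \near x, P y.
Proof.
move=> ax xb PP; near=> y; apply: PP.
- by near: y; exact: lt_nbhsr.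
- by near: y; exact: lt_nbhsl.
Unshelve. all: by end_near. Qed.

Lemma integral_ae_derivable a b f g : mu.-integrable setT (EFin \o g) ->
  (forall x, a <= x -> x <= b -> f x - f a = \int[mu]_(t in `]a, x]) g t) ->
  {ae mu, forall x, a < x < b -> derivable f x 1 /\ derive1 f x = g x}.
Proof.
move=> ig fE.
have lg : locally_integrable setT g by apply: open_integrable_locally => //; exact: openT.
have igy y : mu.-integrable [set` Interval (BRight a) (BRight y)] (EFin \o g).
  exact: integrableS ig.
have := FTC1 igy lg; apply: filterS; first exact: (ae_filter_ringOfSetsType mu).
move=> x H /andP[ax xb].
have [] := H; first exact: ax.
set G := fun y => _ => dG GE.
have near_fG : {near x, (fun y => f a + G y) =1 f}.
  apply: (near_itv_oo ax xb) => y ay yb.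
  by rewrite /G -fE ?ltW// addrC subrK.
have dfG : derivable (fun y => f a + G y) x 1 by exact: derivableD.
split; first exact: near_eq_derivable dfG.
rewrite -(near_eq_derive1 near_fG) -GE !derive1E deriveD// derive_cst add0r//.
Qed.

End Representation.
(** * Borel measurability of the derivative *)

Section MeasurableDerivative.
Context {R : realType}.
Implicit Types (a b c : R) (f g F : R -> R).
Local Notation mu := (@lebesgue_measure R).

Definition growth f (h x : R) : R := h^-1 *: (f (h + x) - f x).

Lemma continuous_growth f h : continuous f -> continuous (growth f h).
Proof.
move=> cf x; apply: cvgZl_tmp; apply: cvgB; last exact: cf.
apply: (@continuous_comp _ _ _ (fun y => h + y) f); last exact: cf.
by apply: cvgD; [exact: cvg_cst|exact: cvg_id].
Qed.

(* Cauchy's criterion for the existence of the derivative quantifies over all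
   small increments, hence gives an intersection of closed sets. *)
Definition growth_close f k n : set R :=
  \bigcap_(p in [set p : R * R | 0 < `|p.1| < n.+1%:R^-1 /\
                                  0 < `|p.2| < n.+1%:R^-1])
    [set x | `|growth f p.1 x - growth f p.2 x| <= k.+1%:R^-1].

Lemma closed_growth_close f k n : continuous f -> closed (growth_close f k n).
Proof.
move=> cf; apply: closed_bigI => p _.
apply: (@preimage_closed _ _ (fun x => `|growth f p.1 x - growth f p.2 x|)
  [set y | y <= k.+1%:R^-1]); last exact: closed_le.
move=> x _; have c1 := @continuous_growth f p.1 cf x.
have c2 := @continuous_growth f p.2 cf x.
exact: (cvg_norm (cvgB c1 c2)).
Qed.

Lemma derivable_growth_close f x :
  derivable f x 1 <-> (\bigcap_k \bigcup_n growth_close f k n) x.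
Proof.
have E : (fun h : R => h^-1 *: ((f \o shift x) (h *: 1) - f x)) = growth f ^~ x.
  by apply/funext => h; rewrite /growth /= [h%:A]mulr1.
rewrite /derivable E; split=> [/cvg_ex[l fl] k _|H].
  have k0 : 0 < k.+1%:R^-1 / 2 :> R by rewrite divr_gt0// invr_gt0.
  have := (cvgrPdist_le _ _).1 fl _ k0; rewrite near_withinE => -[r /= r0 rl].
  have [n nr] : exists n : nat, n.+1%:R^-1 < r.
    exists (Num.bound r^-1).
    rewrite invf_plt ?posrE//; apply: lt_trans (archi_boundP _) _.
      by rewrite invr_ge0 ltW.
    by rewrite ltr_nat.
  have H h : 0 < `|h| < n.+1%:R^-1 -> `|l - growth f h x| <= k.+1%:R^-1 / 2.
    move=> /andP[h0 hn]; apply: rl; last by rewrite -normr_gt0.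
    by rewrite /= sub0r normrN (lt_trans hn).
  exists n => // p [/H p1 /H p2] /=.
  have := ler_distD l (growth f p.1 x) (growth f p.2 x).
  rewrite [`|_ - l|]distrC => /le_trans; apply.
  by rewrite (splitr k.+1%:R^-1) lerD.
apply/cauchy_cvgP/cauchy_exP => e e0.
have [k ke] : exists k : nat, k.+1%:R^-1 < e.
  exists (Num.bound e^-1).
  rewrite invf_plt ?posrE//; apply: lt_trans (archi_boundP _) _.
    by rewrite invr_ge0 ltW.
  by rewrite ltr_nat.
have [n _ Hn] := H k I.
(* Any quotient with a nonzero increment below the threshold can serve as the centre of the Cauchy
   ball; half the threshold is such an increment. *)
exists (growth f (n.+1%:R^-1 / 2) x).
have n0 : 0 < n.+1%:R^-1 :> R by rewrite invr_gt0.
exists n.+1%:R^-1 => //= h /=.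
rewrite sub0r normrN => hn h0; apply: le_lt_trans ke.
apply: (Hn (n.+1%:R^-1 / 2, h)) => /=; split; last by rewrite normr_gt0 h0.
have n2 : 0 < n.+1%:R^-1 / 2 :> R by rewrite divr_gt0.
by rewrite gtr0_norm// n2/= ltr_pdivrMr// ltr_pMr// ltr1n.
Qed.

Lemma measurable_derivable f : continuous f ->
  measurable [set x | derivable f x 1].
Proof.
move=> cf; rewrite (_ : [set _ | _] = \bigcap_k \bigcup_n growth_close f k n).
  apply: bigcapT_measurable => k; apply: bigcupT_measurable => n.
  by apply: closed_measurable; exact: closed_growth_close.
by apply/seteqP; split => x /derivable_growth_close.
Qed.

Lemma measurable_derive1 f : continuous f -> measurable_fun setT (derive1 f).
Proof.
move=> cf.
(* [point] is the value of [derive1] where the limit does not exist, so [q] converges to [derive1 f]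
   everywhere. *)
pose q n x := if `[< derivable f x 1 >] then growth f n.+1%:R^-1 x else point.
apply: (@measurable_fun_cvg _ _ _ _ q) => [n|x _].
  apply: measurable_fun_ifT => //.
    apply: (measurable_fun_bool true); rewrite setTI.
    rewrite (_ : _ @^-1` _ = [set x | derivable f x 1]).
      exact: measurable_derivable.
    by apply/seteqP; split => x /= /asboolP.
  by apply: continuous_measurable_fun; exact: continuous_growth.
rewrite /q; case: asboolP => df; last first.
  rewrite /derive1; rewrite dvgP; first exact: cvg_cst.
  move=> H; apply: df; rewrite /derivable.
  suff -> : (fun h : R => h^-1 *: ((f \o shift x) (h *: 1) - f x)) =
     (fun h : R => h^-1 *: (f (h + x) - f x)) by [].
  by apply/funext => h; rewrite /= [h%:A]mulr1.
have := df; rewrite /derivable -/('D_1 f x) => cvf.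
have {cvf} : growth f h x @[h --> 0^'] --> derive1 f x.
  rewrite derive1E /derive.
  rewrite (_ : growth f ^~ x = fun h : R => h^-1 *: ((f \o shift x) (h *: 1) - f x)) //.
  by apply/funext => h; rewrite /growth /= [h%:A]mulr1.
move=> /cvgrPdist_lt H; apply/cvgrPdist_lt => e e0.
have := H _ e0; rewrite near_withinE => -[r /= r0 rl].
near=> n; apply: rl; last by rewrite invr_neq0// pnatr_eq0.
rewrite /= sub0r normrN ger0_norm ?invr_ge0//.
by near: n; exact: (near_infty_natSinv_lt (PosNum r0)).
Unshelve. all: by end_near. Qed.

End MeasurableDerivative.
(** * The fundamental theorem of calculus and integration by parts *)

Section FundamentalTheorem.
Context {R : realType}.
Implicit Types (a b c x y : R) (f g phi psi : R -> R).
Local Notation mu := (@lebesgue_measure R).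

Lemma integrable_measurable (D : set R) f :
  mu.-integrable D (EFin \o f) -> measurable_fun D f.
Proof. by move/integrableP => [/measurable_EFinP]. Qed.

Lemma abs_continuous_chainS a b c d f : a <= c -> d <= b ->
  abs_continuous_chain a b f -> abs_continuous_chain c d f.
Proof.
move=> ac db acf e e0; have [r r0 H] := acf e e0; exists r => // L cL Lr.
apply: H => //; have := @chain_cat _ a [::] c L d ac cL.
move=> /(@chain_cat _ a L d [::] b); rewrite cats0; exact.
Qed.

Lemma lipschitz_abs_continuous a b phi (M : R) :
  (forall x y, a <= x -> x <= y -> y <= b -> `|phi y - phi x| <= M * (y - x)) ->
  abs_continuous_on a b phi.
Proof.
move=> lip e e0; have M1 : 0 < `|M| + 1 by rewrite ltr_wpDl.
exists (e / (`|M| + 1)); first by rewrite divr_gt0.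
move=> n s t st _; rewrite ltr_pdivlMr// => H; apply: le_lt_trans H.
rewrite mulr_suml; apply: ler_sum => i _.
have [? [? ?]] := st i; apply: le_trans (lip _ _ _ _ _) _ => //.
rewrite mulrC ler_wpM2l ?subr_ge0//.
by apply: le_trans (ler_norm _) _; rewrite lerDl.
Qed.

Lemma abs_continuous_chain_le a b f : a <= b -> abs_continuous_chain a b f ->
  exists2 M : R, 0 < M & forall x, a <= x -> x <= b -> `|f x| <= M.
Proof.
move=> ab acf; have bv := abs_continuous_bounded_variation ab acf.
have finb : total_variation a b f \is a fin_num by exact/bounded_variationP.
exists (`|f a| + fine (total_variation a b f) + 1).
  by rewrite ltr_pwDr// addr_ge0// fine_ge0// total_variation_ge0.
move=> x ax xb.
have : (`|f x - f a|%:E <= total_variation a b f)%E.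
  rewrite (total_variationD f ax xb); apply: le_trans (total_variation_ge f ax) _.
  by rewrite leeDl// total_variation_ge0.
rewrite -[X in (_ <= X)%E](fineK finb) lee_fin.
have := ler_normD (f x - f a) (f a); rewrite subrK; lra.
Qed.

Lemma abs_continuous_chainM a b f g : a <= b -> abs_continuous_chain a b f ->
  abs_continuous_chain a b g -> abs_continuous_chain a b (fun x => f x * g x).
Proof.
move=> ab acf acg e e0.
have [M M0 fM] := abs_continuous_chain_le ab acf.
have [N N0 gN] := abs_continuous_chain_le ab acg.
have eM : 0 < e / (2 * M) by rewrite divr_gt0// mulr_gt0.
have eN : 0 < e / (2 * N) by rewrite divr_gt0// mulr_gt0.
have [d d0 Hf] := acf _ eN; have [d' d'0 Hg] := acg _ eM.
exists (Num.min d d'); first by rewrite lt_min d0.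
move=> L aL; rewrite lt_min => /andP[/(Hf _ aL) fL /(Hg _ aL) gL].
apply: (@le_lt_trans _ _ (N * chain_variation f L + M * chain_variation g L)).
  rewrite /chain_variation !mulr_sumr -big_split/= big_seq [leRHS]big_seq.
  apply: ler_sum => p pL.
  have /and3P[ap pp pb] := allP (chain_all aL) _ pL.
  rewrite (_ : _ * _ - _ * _ = (f p.1 - f p.2) * g p.1 +
    f p.2 * (g p.1 - g p.2)); last by ring.
  apply: le_trans (ler_normD _ _) _; rewrite !normrM lerD//.
    by rewrite mulrC ler_wpM2r// gN// (le_trans ap).
  by rewrite ler_wpM2r// fM// (le_trans pp).
have -> : e = N * (e / (2 * N)) + M * (e / (2 * M)).
  by field; rewrite !gt_eqF.
by rewrite ltrD// ltr_pM2l.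
Qed.

Lemma abs_continuous_measurable a b f : a <= b -> abs_continuous_chain a b f ->
  measurable_fun `[a, b] f.
Proof.
move=> ab acf; apply: (@eq_measurable_fun _ _ _ _ _ (f \o clamp a b)).
  by move=> x; rewrite inE/= in_itv/= => /andP[ax xb]; rewrite clamp_id.
apply: measurable_funTS; apply: continuous_measurable_fun.
exact: abs_continuous_clamp.
Qed.

Lemma abs_continuous_integrable a b f : a <= b -> abs_continuous_chain a b f ->
  mu.-integrable `[a, b] (EFin \o f).
Proof.
move=> ab acf; apply: (@eq_integrable _ _ _ mu _ _ (EFin \o (f \o clamp a b))) => //.
  by move=> x; rewrite inE/= in_itv/= => /andP[ax xb]; rewrite clamp_id.
apply: continuous_compact_integrable; first exact: segment_compact.
by apply: continuous_subspaceT; exact: abs_continuous_clamp.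
Qed.

Lemma derive1_clamp a b f x : a < x < b ->
  derive1 (f \o clamp a b) x = derive1 f x.
Proof.
move=> /andP[ax xb]; apply: near_eq_derive1; apply: (near_itv_oo ax xb) => y ay yb.
by rewrite /= clamp_id// ltW.
Qed.

(** As [f] is arbitrary outside [[a, b]], measurability is taken from its continuous clamped
    extension, which has the same derivative on the open interval. The endpoints, where [derive1 f]
    depends on outside values, are then added. *)
Lemma abs_continuous_measurable_derive1 a b f : a <= b ->
  abs_continuous_chain a b f -> measurable_fun `[a, b] (derive1 f).
Proof.
move=> ab acf; apply: (@measurable_fun_itv_cc _ _ _ false true).
apply: (@eq_measurable_fun _ _ _ _ _ (derive1 (f \o clamp a b))).
  by move=> x; rewrite inE/= in_itv/= => /derive1_clamp.
apply: measurable_funTS; apply: measurable_derive1.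
exact: abs_continuous_clamp.
Qed.

Lemma integrable_set1 (r : R) f : mu.-integrable [set r] (EFin \o f).
Proof.
apply: null_set_integrable => //; last exact: lebesgue_measure_set1.
exact: measurable_fun_set1.
Qed.

Lemma ae_imp (P Q : R -> Prop) : (forall x, P x -> Q x) ->
  {ae mu, forall x, P x} -> {ae mu, forall x, Q x}.
Proof.
move=> PQ; apply: filterS; first exact: (ae_filter_ringOfSetsType mu).
exact: PQ.
Qed.

Lemma ae_imp2 (P Q S : R -> Prop) : (forall x, P x -> Q x -> S x) ->
  {ae mu, forall x, P x} -> {ae mu, forall x, Q x} -> {ae mu, forall x, S x}.
Proof.
move=> PQ; apply: filterS2; first exact: (ae_filter_ringOfSetsType mu).
exact: PQ.
Qed.

Lemma ae_eq_itv_oo_cc a b f g :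
  {ae mu, forall x, a < x < b -> f x = g x} -> f = g %[ae mu in `[a, b]%classic].
Proof.
move=> fg; have ab0 : {ae mu, forall x : R, ~ [set a; b] x}.
  exists [set a; b]; split.
  - exact: measurableU.
  - by rewrite countable_lebesgue_measure0//; exact: finite_set_countable.
  - by move=> x /= /contrapT.
move: fg ab0.
apply: ae_imp2 => x fg xab /=; rewrite in_itv/= => /andP[ax xb].
apply: fg; rewrite !lt_neqAle ax xb !andbT; apply/andP; split.
- by apply/eqP => E; apply: xab; left.
- by apply/eqP => E; apply: xab; right.
Qed.

Lemma ae_eq_integrable (D : set R) f g : measurable D -> measurable_fun D g ->
  f = g %[ae mu in D] -> mu.-integrable D (EFin \o f) ->
  mu.-integrable D (EFin \o g).
Proof.
move=> mD mg fg /integrableP[mf foo]; apply/integrableP; split.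
  exact/measurable_EFinP.
suff -> : (\int[mu]_(x in D) `|(EFin \o g) x| =
    \int[mu]_(x in D) `|(EFin \o f) x|)%E by [].
apply: ae_eq_integral => //.
- by apply: measurableT_comp => //; exact/measurable_EFinP.
- exact: measurableT_comp.
- by apply: ae_imp fg => x /[apply] /= ->.
Qed.

Lemma ae_eq_Rintegral (D : set R) f g : measurable D -> measurable_fun D f ->
  measurable_fun D g -> f = g %[ae mu in D] ->
  \int[mu]_(x in D) f x = \int[mu]_(x in D) g x.
Proof.
move=> mD mf mg fg; congr fine; apply: ae_eq_integral => //.
- exact/measurable_EFinP.
- exact/measurable_EFinP.
- by apply: ae_imp fg => x /[apply] /= ->.
Qed.

Lemma abs_continuous_ae_derivable a b f : a <= b -> abs_continuous_chain a b f ->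
  {ae mu, forall x, a < x < b -> derivable f x 1}.
Proof.
rewrite le_eqVlt => /predU1P[<-|ab] acf.
  by apply: aeW => x; lra.
have [g ig fE] := abs_continuous_integral ab acf.
by have := integral_ae_derivable ig fE; apply: ae_imp => x H /H [].
Qed.

Lemma abs_continuous_FTC a b f : a <= b -> abs_continuous_chain a b f ->
  mu.-integrable `[a, b] (EFin \o derive1 f) /\
  forall x, a <= x -> x <= b ->
    \int[mu]_(t in `[a, x]) derive1 f t = f x - f a.
Proof.
rewrite le_eqVlt => /predU1P[<-|ab] acf.
  rewrite set_itv1; split; first exact: integrable_set1.
  move=> x ax xa; have -> : x = a by lra.
  by rewrite set_itv1 Rintegral_set1 subrr.
have [g ig fE] := abs_continuous_integral ab acf.
have mf := abs_continuous_measurable_derive1 (ltW ab) acf.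
have gf : g = derive1 f %[ae mu in `[a, b]%classic].
  apply: ae_eq_itv_oo_cc; have := integral_ae_derivable ig fE.
  by apply: ae_imp => x H /H [_ ->].
have igab : mu.-integrable `[a, b] (EFin \o g) by exact: integrableS ig.
split; first exact: (ae_eq_integrable _ mf gf igab).
move=> x ax xb; have sub : `[a, x] `<=` `[a, b] by apply: subset_itvl; rewrite bnd_simp.
rewrite fE// Rintegral_itv_obnd_cbnd; last exact: integrableS ig.
apply: ae_eq_Rintegral => //.
- exact: measurable_funS mf.
- apply: (measurable_funS _ sub) => //.
  exact: integrable_measurable igab.
- by apply: ae_imp gf => y H /sub /H ->.
Qed.

Lemma integrable_mul_abs_continuous a b f g : a <= b ->
  abs_continuous_chain a b g -> mu.-integrable `[a, b] (EFin \o f) ->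
  mu.-integrable `[a, b] (EFin \o (fun x => f x * g x)).
Proof.
move=> ab acg fi; have [M M0 gM] := abs_continuous_chain_le ab acg.
apply: (@eq_integrable _ _ _ mu _ _ ((EFin \o f) \* (EFin \o g))%E) => //.
apply: (@integrableMl _ _ _ mu _ _ (EFin \o f) g) => //.
  exact: abs_continuous_measurable.
exists M; split; first exact: num_real.
move=> y My x; rewrite /= in_itv/= => /andP[ax xb].
by apply: le_trans (ltW My); exact: gM.
Qed.

(** The fundamental theorem is applied to the product [f * phi], again absolutely continuous; the
    product rule holds wherever [f] is derivable, hence almost everywhere. *)
Lemma abs_continuous_integration_by_parts a b f phi psi : a <= b ->
  abs_continuous_chain a b f -> abs_continuous_chain a b phi ->
  (forall x, is_derive x (1 : R) phi (psi x)) -> continuous psi ->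
  mu.-integrable `[a, b] (EFin \o (fun x => derive1 f x * phi x)) /\
  \int[mu]_(x in `[a, b]) (derive1 f x * phi x) =
    f b * phi b - f a * phi a - \int[mu]_(x in `[a, b]) (f x * psi x).
Proof.
move=> ab acf acphi dphi cpsi.
have acM := abs_continuous_chainM ab acf acphi.
have [i1 /(_ b ab (lexx b)) E1] := abs_continuous_FTC ab acM.
have [i2 _] := abs_continuous_FTC ab acf.
have mab : measurable `[a, b]%classic by exact: measurable_itv.
have iphi := integrable_mul_abs_continuous ab acphi i2.
have ipsi : mu.-integrable `[a, b] (EFin \o (fun x => f x * psi x)).
  apply: (@eq_integrable _ _ _ mu _ _ (EFin \o (fun x => (f \o clamp a b) x * psi x))) => //.
    by move=> x; rewrite inE/= in_itv/= => /andP[ax xb]; rewrite clamp_id.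
  apply: continuous_compact_integrable; first exact: segment_compact.
  apply: continuous_subspaceT => x.
  by apply: cvgM; [exact: abs_continuous_clamp|exact: cpsi].
split=> //; apply/eqP; rewrite eq_sym subr_eq -RintegralD// eq_sym; apply/eqP.
rewrite -E1; apply/esym.
apply: ae_eq_Rintegral => //.
- exact: abs_continuous_measurable_derive1.
- exact: measurable_funD (integrable_measurable iphi) (integrable_measurable ipsi).
- apply: ae_eq_itv_oo_cc; have := abs_continuous_ae_derivable ab acf.
  apply: ae_imp => x H /H df.
  have [dp dpE] := dphi x.
  by rewrite !derive1E deriveM// dpE /GRing.scale/=; ring.
Qed.

End FundamentalTheorem.
(** * An upper bound on pi *)

Section PiBound.
Context {R : realType}.

Lemma ge0_is_derive (F dF : R -> R) : (forall x, is_derive x (1 : R) F (dF x)) ->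
  F 0 = 0 -> (forall x, 0 <= x -> 0 <= dF x) -> forall x, 0 <= x -> 0 <= F x.
Proof.
move=> dFE F0 dF0 x x0.
have cF : {within `[0, x], continuous F}.
  apply: continuous_subspaceT => y; apply: differentiable_continuous.
  by apply/derivable1_diffP; have [] := dFE y.
have [c + E] := MVT_segment x0 (fun y _ => dFE y) cF.
rewrite in_itv/= => /andP[c0 _].
by move: E; rewrite F0 !subr0 => ->; rewrite mulr_ge0// dF0.
Qed.

(** Starting from [cos <= 1], four successive integrations from 0 raise the Taylor degree by one
    each. *)
Lemma cos_le_poly4 (x : R) : 0 <= x -> cos x <= 1 - x ^+ 2 / 2 + x ^+ 4 / 24.
Proof.
have s1 (y : R) : 0 <= y -> 0 <= y - sin y.
  move: y; apply (@ge0_is_derive (fun y => y - sin y) (fun y => 1 - cos y)).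
  - by move=> z; apply: is_derive_eq; rewrite /GRing.scale/=; ring.
  - by rewrite sin0; ring.
  - by move=> z _; have := cos_le1 z; lra.
have c2 (y : R) : 0 <= y -> 0 <= cos y - (1 - y ^+ 2 / 2).
  move: y; apply (@ge0_is_derive (fun y => cos y - (1 - y ^+ 2 / 2))
    (fun y => y - sin y)) => //.
  - by move=> z; apply: is_derive_eq; rewrite /GRing.scale/=; field.
  - by rewrite cos0; ring.
have s3 (y : R) : 0 <= y -> 0 <= sin y - (y - y ^+ 3 / 6).
  move: y; apply (@ge0_is_derive (fun y => sin y - (y - y ^+ 3 / 6))
    (fun y => cos y - (1 - y ^+ 2 / 2))) => //.
  - by move=> z; apply: is_derive_eq; rewrite /GRing.scale/=; field.
  - by rewrite sin0; ring.
move=> x0; rewrite -subr_ge0; move: x x0.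
apply (@ge0_is_derive (fun y => 1 - y ^+ 2 / 2 + y ^+ 4 / 24 - cos y)
  (fun y => sin y - (y - y ^+ 3 / 6))) => //.
- by move=> z; apply: is_derive_eq; rewrite /GRing.scale/=; field.
- by rewrite cos0; ring.
Qed.

Lemma pi_sqr_lt12 : (pi : R) ^+ 2 < 12.
Proof.
(* The quartic bound on [cos] is negative at [17 / 10], which therefore cannot lie below [pi / 2];
   and [(34 / 10) ^+ 2 = 11.56 < 12]. *)
have : (pi : R) / 2 <= 17 / 10.
  rewrite leNgt; apply/negP => H.
  have x0 : (0 : R) <= 17 / 10 by lra.
  have := cos_le_poly4 x0.
  have : 0 < cos (17 / 10 : R) by apply: cos_gt0_pihalf; rewrite H andbT; lra.
  by rewrite !exprS expr0; lra.
have := @pi_gt0 R; nra.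
Qed.

End PiBound.

(** * Primitives of integrable functions *)

Section Primitive.
Context {R : realType}.
Implicit Types (a b c x y : R) (f g : R -> R).
Local Notation mu := (@lebesgue_measure R).

Lemma chain_enum a b n (s t : 'I_n -> R) : a <= b ->
  (forall i, a <= s i /\ s i <= t i /\ t i <= b) ->
  (forall i j : 'I_n, (i < j)%N -> t i <= s j) ->
  chain a [seq (t i, s i) | i <- enum 'I_n] b.
Proof.
elim: n b s t => [|n IH] b s t ab st ts; first by rewrite enum_ord0.
rewrite enum_ordSr map_rcons -cats1 -map_comp.
have [? [? ?]] := st ord_max.
apply: (@chain_cat _ _ _ (s ord_max)); last by rewrite /=; apply/and3P.
apply: (IH _ (s \o widen_ord (leqnSn n)) (t \o widen_ord (leqnSn n))) => //=.
- move=> i; have [? [? ?]] := st (widen_ord (leqnSn n) i).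
  by split=> //; split=> //; apply: ts => /=.
- by move=> i j ij; exact: ts.
Qed.

Lemma abs_continuous_chainW a b f : a <= b ->
  abs_continuous_chain a b f -> abs_continuous_on a b f.
Proof.
move=> ab acf e e0; have [d d0 H] := acf e e0; exists d => // n s t st ts std.
have := H _ (chain_enum ab st ts).
have E (G : R * R -> R) : \sum_(p <- [seq (t i, s i) | i <- enum 'I_n]) G p =
    \sum_i G (t i, s i) by rewrite big_map big_enum.
by rewrite /chain_length /chain_variation !E; exact.
Qed.

Lemma Rintegral_chain_set a b g L : mu.-integrable setT (EFin \o g) ->
  chain a L b ->
  \int[mu]_(x in chain_set L) g x = \sum_(p <- L) \int[mu]_(x in `]p.2, p.1]) g x.
Proof.
move=> ig; elim: L a => [|p L IH] a /=.
  by rewrite /chain_set !big_nil Rintegral_set0.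
move=> /and3P[ap pp pL]; rewrite /chain_set !big_cons -/(chain_set L).
have mL := measurable_chain_set L.
rewrite Rintegral_setU//.
- by rewrite (IH _ pL).
- by apply: integrableS ig => //; exact: measurableU.
- apply/disj_setPS => x [/= + /(chain_set_subset pL)/=].
  by rewrite !in_itv/=; lra.
Qed.

Lemma abs_continuous_primitive a b f g : mu.-integrable setT (EFin \o g) ->
  (forall x, a <= x -> x <= b -> f x - f a = \int[mu]_(t in `]a, x]) g t) ->
  abs_continuous_chain a b f.
Proof.
move=> ig fE e e0; have [d [d0 H]] := integral_normr_continuous ig e0.
exists d => // L aL Ld.
have mL := measurable_chain_set L.
have {}H : \int[mu]_(x in chain_set L) `|g x| < e.
  apply: H => //; rewrite (@measure_chain_set _ mu idfun a b)//.
  move=> x y _ xy _; apply: (etrans (lebesgue_measure_itv `]x, y])).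
  by rewrite /= lte_fin; case: ltgtP xy => // -> _; rewrite subrr.
apply: le_lt_trans H; have ing := integrable_norm ig.
rewrite (Rintegral_chain_set ing aL) /chain_variation big_seq [leRHS]big_seq.
apply: ler_sum => p /(allP (chain_all aL))/and3P[ap pp pb].
have -> : f p.1 - f p.2 = \int[mu]_(t in `]p.2, p.1]) g t.
  have a1 : a <= p.1 by apply: le_trans pp.
  have b2 : p.2 <= b by apply: le_trans pb.
  rewrite -(@Rintegral_itvB _ g (BRight a) (BRight p.1) p.2).
  - by rewrite -!fE//; ring.
  - exact: integrableS ig.
  - by rewrite bnd_simp.
  - by rewrite bnd_simp.
by apply: le_normr_Rintegral => //; exact: integrableS ig.
Qed.

End Primitive.

(** * Square-integrable functions *)

Section SquareIntegrable.
Context {R : realType}.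
Implicit Types (D : set R) (f g : R -> R).
Local Notation mu := (@lebesgue_measure R).

(** Integrability of the square does not make [f] itself measurable, whence the separate first
    clause. *)
Definition square_integrable D f := measurable_fun D f /\
  mu.-integrable D (EFin \o (fun x => f x ^+ 2)).

Lemma integrable_fun_add D f g : measurable D -> mu.-integrable D (EFin \o f) ->
  mu.-integrable D (EFin \o g) ->
  mu.-integrable D (EFin \o (fun x => f x + g x)).
Proof.
move=> mD fi gi.
by apply: (@eq_integrable _ _ _ mu _ _ ((EFin \o f) \+ (EFin \o g))%E) => //;
  exact: integrableD.
Qed.

Lemma integrable_fun_sub D f g : measurable D -> mu.-integrable D (EFin \o f) ->
  mu.-integrable D (EFin \o g) ->
  mu.-integrable D (EFin \o (fun x => f x - g x)).
Proof.
move=> mD fi gi.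
by apply: (@eq_integrable _ _ _ mu _ _ ((EFin \o f) \- (EFin \o g))%E) => //;
  exact: integrableB.
Qed.

Lemma integrable_fun_scale D k f : measurable D -> mu.-integrable D (EFin \o f) ->
  mu.-integrable D (EFin \o (fun x => k * f x)).
Proof.
move=> mD fi.
by apply: (@eq_integrable _ _ _ mu _ _ (fun x => k%:E * (EFin \o f) x)%E) => //;
  exact: integrableZl.
Qed.

Lemma square_integrableM D f g : measurable D -> square_integrable D f ->
  square_integrable D g -> mu.-integrable D (EFin \o (fun x => f x * g x)).
Proof.
move=> mD [mf f2] [mg g2].
apply: (@le_integrable _ _ _ mu D mD _ (EFin \o (fun x => f x ^+ 2 + g x ^+ 2))).
- by apply/measurable_EFinP; exact: measurable_funM.
- move=> x Dx; rewrite /= lee_fin normrM [leRHS]ger0_norm ?addr_ge0 ?sqr_ge0//.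
  rewrite -(real_normK (num_real (f x))) -(real_normK (num_real (g x))).
  by have := sqr_ge0 (`|f x| - `|g x|); have := sqr_ge0 (`|f x| + `|g x|); nra.
- exact: integrable_fun_add.
Qed.

Lemma square_integrableD D f g : measurable D -> square_integrable D f ->
  square_integrable D g -> square_integrable D (fun x => f x + g x).
Proof.
move=> mD Df Dg; have [mf f2] := Df; have [mg g2] := Dg.
have fg := square_integrableM mD Df Dg.
split; first exact: measurable_funD.
have := integrable_fun_add mD (integrable_fun_add mD f2 g2)
  (integrable_fun_add mD fg fg).
by apply: eq_integrable => // x _ /=; congr EFin; ring.
Qed.

Lemma square_integrableZ D k f : measurable D -> square_integrable D f ->
  square_integrable D (fun x => k * f x).
Proof.
move=> mD [mf f2]; split; first exact: measurable_funM.
have := integrable_fun_scale (k ^+ 2) mD f2.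
by apply: eq_integrable => // x _ /=; rewrite exprMn.
Qed.

Lemma square_integrableB D f g : measurable D -> square_integrable D f ->
  square_integrable D g -> square_integrable D (fun x => f x - g x).
Proof.
move=> mD Df Dg; have := square_integrableD mD Df (square_integrableZ (-1) mD Dg).
by rewrite (_ : (fun x => f x - g x) = (fun x => f x + -1 * g x))//;
  apply/funext => x; ring.
Qed.

Lemma bounded_square_integrable D f (M : R) : measurable D -> (mu D < +oo)%E ->
  measurable_fun D f -> (forall x, D x -> `|f x| <= M) -> square_integrable D f.
Proof.
move=> mD Doo mf fM; split=> //.
apply: (@measurable_bounded_integrable _ _ _ mu (fun x => f x ^+ 2)) => //.
  exact: measurable_funX.
exists (M ^+ 2); split; first exact: num_real.
move=> y My x Dx; apply: le_trans (ltW My).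
by rewrite normrX ler_sqr ?nnegrE// ?fM// (le_trans _ (fM _ Dx)).
Qed.

Lemma ae_eq_square_integrable D f g : measurable D -> measurable_fun D g ->
  f = g %[ae mu in D] -> square_integrable D f -> square_integrable D g.
Proof.
move=> mD mg fg [mf f2]; split=> //.
apply: (@ae_eq_integrable _ D (fun x => f x ^+ 2) (fun x => g x ^+ 2)) => //.
  exact: measurable_funX.
by apply: ae_imp fg => x H Dx; rewrite H.
Qed.

Lemma Cauchy_Schwarz_integral D f g : measurable D -> square_integrable D f ->
  square_integrable D g -> 0 < \int[mu]_(x in D) (g x ^+ 2) ->
  (\int[mu]_(x in D) (f x * g x)) ^+ 2 <=
    \int[mu]_(x in D) (f x ^+ 2) * \int[mu]_(x in D) (g x ^+ 2).
Proof.
move=> mD Df Dg; have [mf f2] := Df; have [mg g2] := Dg.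
have fg := square_integrableM mD Df Dg.
set N := \int[mu]_(x in D) (g x ^+ 2); set P := \int[mu]_(x in D) (f x * g x).
set F := \int[mu]_(x in D) (f x ^+ 2) => N0.
(* This is [N] times the difference between [f] and its projection [(P / N) g] on [g]; the scaling
   avoids division. *)
have : 0 <= \int[mu]_(x in D) ((N * f x - P * g x) ^+ 2).
  by apply: Rintegral_ge0 => x _; exact: sqr_ge0.
have -> : \int[mu]_(x in D) ((N * f x - P * g x) ^+ 2) =
    \int[mu]_(x in D) (N ^+ 2 * f x ^+ 2 - (2 * N * P) * (f x * g x)
                       + P ^+ 2 * g x ^+ 2).
  by apply: eq_Rintegral => x _; ring.
have i1 : mu.-integrable D (EFin \o (fun x => N ^+ 2 * f x ^+ 2)).
  exact: integrable_fun_scale.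
have i2 : mu.-integrable D (EFin \o (fun x => (2 * N * P) * (f x * g x))).
  exact: integrable_fun_scale.
have i3 : mu.-integrable D (EFin \o (fun x => P ^+ 2 * g x ^+ 2)).
  exact: integrable_fun_scale.
rewrite RintegralD//; last exact: integrable_fun_sub.
rewrite RintegralB// !RintegralZl// -/N -/P -/F.
have -> : N ^+ 2 * F - 2 * N * P * P + P ^+ 2 * N = N * (F * N - P ^+ 2) by ring.
by rewrite pmulr_rge0// subr_ge0.
Qed.

End SquareIntegrable.
(** * The Riesz-Fischer theorem *)

Section RieszFischer.
Context {R : realType}.
Implicit Types (D : set R) (f g : R -> R).
Local Notation mu := (@lebesgue_measure R).

Lemma integral_EFinE D f : measurable D -> mu.-integrable D (EFin \o f) ->
  (\int[mu]_(x in D) (f x)%:E = (\int[mu]_(x in D) f x)%:E)%E.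
Proof. by move=> mD fi; rewrite /Rintegral fineK//; exact: integrable_fin_num. Qed.

Lemma integrable_cst D k : measurable D -> (mu D < +oo)%E ->
  mu.-integrable D (EFin \o cst k).
Proof.
move=> mD Doo; apply: (@measurable_bounded_integrable _ _ _ mu (cst k)) => //.
by exists `|k|; split=> // y /ltW ky x _.
Qed.

Lemma limn_einf_le (u : nat -> \bar R) (e : \bar R) :
  (\forall n \near \oo, (u n <= e)%E) -> (limn_einf u <= e)%E.
Proof.
move=> ue; rewrite limn_einf_lim; apply: lime_le; first exact: is_cvg_einfs.
near=> n; apply: (@le_trans _ _ (u n)); last by near: n.
by apply: ereal_inf_lbound => /=; exists n => //=.
Unshelve. all: by end_near. Qed.

Lemma summable_increments_cvg (v : nat -> R) :
  (\sum_(0 <= k <oo) (`|v k.+1 - v k|)%:E < +oo)%E -> cvgn v.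
Proof.
set S := (\sum_(0 <= k <oo) _)%E => Soo.
have S0 : (0 <= S)%E by apply: nneseries_ge0 => n _ _; rewrite lee_fin.
have Sfin : S \is a fin_num by rewrite ge0_fin_numE.
have cS : cvgn (series (fun n => `|telescope v n|)).
  apply: nondecreasing_is_cvgn.
    apply/nondecreasing_seqP => n; rewrite seriesEnat/= big_nat_recr//=.
    by rewrite lerDl.
  exists (fine S) => _ [n _ <-]; rewrite -lee_fin fineK// seriesEnat/=.
  rewrite -sumEFin; apply: (@nneseries_lim_ge _ _ xpredT) => k _ _.
  by rewrite lee_fin.
have /cvg_ex[/= l cl] : cvgn (series (telescope v)) := @normed_cvg R R (telescope v) cS.
apply/cvg_ex; exists (v 0%N + l).
have cD : v 0%N + series (telescope v) n @[n --> \oo] --> v 0%N + l.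
  by apply: cvgD; [exact: cvg_cst|exact: cl].
apply: cvg_trans cD; apply: near_eq_cvg; apply: nearW => n.
by rewrite [RHS]eq_sum_telescope.
Qed.

Lemma measurable_fun_limn_einf D (f : nat -> R -> \bar R) :
  (forall n, measurable_fun D (f n)) ->
  measurable_fun D (fun x => limn_einf (f ^~ x)).
Proof.
move=> mf; rewrite (_ : (fun _ => _) =
    (fun x => - limn_esup ((fun n => (\- f n)%E) ^~ x))%E).
  apply: measurableT_comp => //; apply: measurable_fun_limn_esup => n.
  exact: measurableT_comp.
by apply/funext => x; rewrite -limn_einfN; congr limn_einf;
  apply/funext => n /=; rewrite oppeK.
Qed.

Lemma half_pow_gt0 k : 0 < (2 ^ k.+1)%:R^-1 :> R.
Proof. by rewrite invr_gt0 ltr0n expn_gt0. Qed.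

(** The sum of the absolute increments has a finite integral, so it is finite almost everywhere, and
    there the sequence converges absolutely. *)
Lemma ae_cvg_fast_Cauchy D (v : nat -> R -> R) : measurable D ->
  (mu D < +oo)%E -> (forall k, square_integrable D (v k)) ->
  (forall k, \int[mu]_(x in D) ((v k.+1 x - v k x) ^+ 2) <=
             (2 ^ k.+1)%:R^-1 ^+ 2) ->
  {ae mu, forall x, D x -> cvgn (v ^~ x)}.
Proof.
move=> mD Doo Dv fast.
pose r k : R := (2 ^ k.+1)%:R^-1.
pose d k x : R := `|v k.+1 x - v k x|.
pose m := fine (mu D).
have mDE : mu D = m%:E by rewrite fineK// ge0_fin_numE.
have m0 : 0 <= m by rewrite fine_ge0.
have d0 k x : 0 <= d k x := normr_ge0 _.
have md k : measurable_fun D (d k).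
  apply: measurableT_comp => //; apply: measurable_funB.
  - exact: (Dv _).1.
  - exact: (Dv _).1.
have bd k : (\int[mu]_(x in D) (d k x)%:E <= ((1 + m) / (2 ^ k.+1)%:R)%:E)%E.
  have Dd := square_integrableB mD (Dv k.+1) (Dv k).
  have id := integrable_fun_scale (r k)^-1 mD Dd.2.
  have ic : mu.-integrable D (EFin \o cst (r k)).
    exact: integrable_cst.
  (* The inequality [|w| <= w^2 / r + r] passes from [L_2] to [L_1]. With [r = 2^-(k+1)] the two
     terms integrate to at most [r] and [r * m], both summable in [k]. *)
  apply: (@le_trans _ _ (\int[mu]_(x in D)
     ((r k)^-1 * (v k.+1 x - v k x) ^+ 2 + r k)%:E)%E).
    apply: ge0_le_integral => //.
    - by move=> x _; rewrite lee_fin d0.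
    - by apply/measurable_EFinP; exact: md.
    - apply/measurable_EFinP; apply: measurable_funD => //.
      exact: integrable_measurable id.
    - move=> x _; rewrite lee_fin /d; set w := _ - _.
      rewrite -(real_normK (num_real w)).
      have r0 : 0 < r k := half_pow_gt0 k.
      rewrite -(ler_pM2l r0) mulrDr mulrA divff ?gt_eqF// mul1r.
      by have := sqr_ge0 (`|w| - r k); have := normr_ge0 w; nra.
  rewrite integral_EFinE//; last exact: integrable_fun_add.
  rewrite lee_fin RintegralD// RintegralZl//; last exact: Dd.2.
  rewrite Rintegral_cst// -/m mulrDl mul1r lerD//; last by rewrite mulrC.
  rewrite ler_pdivrMl ?half_pow_gt0//; exact: le_trans (fast k) _.
pose S x := (\sum_(0 <= k <oo) (d k x)%:E)%E.
have mS : measurable_fun D S.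
  apply: ge0_emeasurable_sum => [k x _ _|k _]; first by rewrite lee_fin d0.
  by apply/measurable_EFinP; exact: md.
have Sint : mu.-integrable D S.
  apply/integrableP; split => //.
  under eq_integral => x _.
    rewrite gee0_abs; last by apply: nneseries_ge0 => n _ _; rewrite lee_fin d0.
    over.
  rewrite integral_nneseries//; last 2 first.
  - by move=> n; apply/measurable_EFinP; exact: md.
  - by move=> n x _; rewrite lee_fin d0.
  apply: (@le_lt_trans _ _ (1 + m)%:E); last exact: ltry.
  have m1 : 0 <= 1 + m by lra.
  apply: le_trans (epsilon_trick0 xpredT m1).
  apply: lee_nneseries => // n _ _.
  by apply: integral_ge0 => x _; rewrite lee_fin d0.
have : {ae mu, forall x, D x -> S x \is a fin_num} by exact: integrable_ae.
apply: ae_imp => x H /H Sx.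
apply: summable_increments_cvg; rewrite -/(S x).
by rewrite -ge0_fin_numE//; apply: nneseries_ge0 => n _ _; rewrite lee_fin d0.
Qed.

Theorem square_integrable_complete D (g : nat -> R -> R) : measurable D ->
  (mu D < +oo)%E -> (forall n, square_integrable D (g n)) ->
  (forall e : R, 0 < e -> exists N, forall m n, (N <= m)%N -> (N <= n)%N ->
     \int[mu]_(x in D) ((g m x - g n x) ^+ 2) <= e) ->
  exists2 G : R -> R, square_integrable D G &
    forall e : R, 0 < e -> exists N, forall n, (N <= n)%N ->
      \int[mu]_(x in D) ((g n x - G x) ^+ 2) <= e.
Proof.
move=> mD Doo Dg cg.
have r0 k : 0 < (2 ^ k.+1)%:R^-1 ^+ 2 :> R by rewrite exprn_gt0// half_pow_gt0.
have [N NP] := choice (fun k => cg _ (r0 k)).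
(* Partial sums make the indices monotone and at least [N k]; the summand [k] makes them tend to
   infinity. *)
pose i k := (k + \sum_(j < k.+1) N j)%N.
have iN k : (N k <= i k)%N by rewrite /i big_ord_recr/= addnA leq_addl.
have iS k : (i k <= i k.+1)%N.
  by rewrite /i [in leqRHS]big_ord_recr/= addSn (leq_trans _ (leqnSn _))// leq_add2l leq_addr.
have ik k : (k <= i k)%N by rewrite leq_addr.
pose v k := g (i k).
have cv : {ae mu, forall x, D x -> cvgn (v ^~ x)}.
  apply: ae_cvg_fast_Cauchy => // k; first exact: Dg.
  by apply: NP => //; apply: leq_trans (iS k).
pose G x := fine (limn_esup (fun k => (v k x)%:E)).
have mG : measurable_fun D G.
  apply: measurableT_comp => //.
  by apply: measurable_fun_limn_esup => k; apply/measurable_EFinP; exact: (Dg _).1.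
have vG : {ae mu, forall x, D x -> v k x @[k --> \oo] --> G x}.
  apply: ae_imp cv => x H /H cvx.
  suff -> : G x = limn (v ^~ x) by [].
  rewrite /G (_ : limn_esup _ = (limn (v ^~ x))%:E)//.
  apply: (cvg_limn_einf_sup _).2.
  by apply: cvg_EFin; [exact: nearW|exact: cvx].
(* Fatou's lemma along the subsequence, with [n] fixed. The bound is in extended reals because
   [g n - G] is not yet known to be square integrable; that is deduced from it in [Dn], and [G] is
   then recovered as [g M - (g M - G)]. *)
have GP e : 0 < e -> exists N, forall n, (N <= n)%N ->
    (\int[mu]_(x in D) ((g n x - G x) ^+ 2)%:E <= e%:E)%E.
  move=> e0; have [M MP] := cg _ e0; exists M => n Mn.
  have mw k : measurable_fun D (fun x => ((g n x - v k x) ^+ 2)%:E).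
    apply/measurable_EFinP; apply: measurable_funX; apply: measurable_funB.
    - exact: (Dg _).1.
    - exact: (Dg _).1.
  have := @fatou _ _ _ mu D mD (fun k x => ((g n x - v k x) ^+ 2)%:E) mw
    (fun k x _ => sqr_ge0 _).
  rewrite (_ : (\int[mu]_(x in D) limn_einf _)%E =
    (\int[mu]_(x in D) ((g n x - G x) ^+ 2)%:E)%E).
    move=> /le_trans; apply; apply: limn_einf_le; near=> k.
    rewrite integral_EFinE//; last exact: (square_integrableB mD (Dg _) (Dg _)).2.
    rewrite lee_fin; apply: MP => //; apply: leq_trans (ik k).
    by near: k; exact: nbhs_infty_ge.
  apply: ae_eq_integral => //.
  - exact: measurable_fun_limn_einf.
  - apply/measurable_EFinP; apply: measurable_funX; apply: measurable_funB => //.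
    exact: (Dg _).1.
  - apply: ae_imp vG => x H /H vx.
    apply: (cvg_limn_einf_sup _).1.
    apply: cvg_EFin; first exact: nearW.
    by apply: cvgM; apply: cvgB => //; exact: cvg_cst.
have Dn n e : (\int[mu]_(x in D) ((g n x - G x) ^+ 2)%:E <= e%:E)%E ->
    square_integrable D (fun x => g n x - G x).
  move=> He; have mgG : measurable_fun D (fun x => g n x - G x).
    by apply: measurable_funB => //; exact: (Dg _).1.
  split=> //; apply/integrableP; split.
    by apply/measurable_EFinP; exact: measurable_funX.
  apply: le_lt_trans (ltry e); apply: le_trans He.
  rewrite le_eqVlt; apply/orP; left; apply/eqP; apply: eq_integral => x _.
  by rewrite /= ger0_norm// sqr_ge0.
exists G.
  have [M MP] := GP _ ltr01.
  have := square_integrableB mD (Dg M) (Dn _ _ (MP _ (leqnn M))).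
  by rewrite (_ : (fun x => _ - _) = G)//; apply/funext => x; ring.
move=> e e0; have [M MP] := GP _ e0; exists M => n Mn.
have H := MP n Mn; have [_ I2] := Dn _ _ H.
by move: H; rewrite integral_EFinE.
Unshelve. all: by end_near. Qed.

End RieszFischer.
(** * Piecewise integrands *)

Section Piecewise.
Context {R : realType}.
Implicit Types (a b x y : R) (f g F : R -> R).
Local Notation mu := (@lebesgue_measure R).

Lemma integrable_setU (A B : set R) f : measurable A -> measurable B ->
  mu.-integrable A (EFin \o f) -> mu.-integrable B (EFin \o f) ->
  mu.-integrable (A `|` B) (EFin \o f).
Proof.
move=> mA mB fA fB; apply/integrable_mkcond; first exact: measurableU.
have fBA : mu.-integrable (B `\` A) (EFin \o f).
  by apply: integrableS fB => //; exact: measurableD.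
have gA : mu.-integrable setT ((EFin \o f) \_ A).
  exact: (@integrable_mkcond _ _ R mu A (EFin \o f) mA).1 fA.
have gBA : mu.-integrable setT ((EFin \o f) \_ (B `\` A)).
  exact: (@integrable_mkcond _ _ R mu _ (EFin \o f) (measurableD mB mA)).1 fBA.
apply: (@eq_integrable _ _ _ mu _ _
  (((EFin \o f) \_ A) \+ ((EFin \o f) \_ (B `\` A)))%E) => //; last first.
  exact: integrableD.
move=> x _; rewrite /= !patchE in_setU in_setD.
by case: (x \in A); case: (x \in B); rewrite /= ?adde0 ?add0e.
Qed.

(** The value of [F] at [x] is left free, a point being null: the intended integrands involve the
    sawtooth, which jumps at [x], and the derivative of the kernel, which has a corner there. *)
Lemma Rintegral_piecewise a b x F F1 F2 : a <= x -> x <= b ->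
  mu.-integrable `[a, x] (EFin \o F1) -> mu.-integrable `[x, b] (EFin \o F2) ->
  (forall y, a <= y -> y < x -> F y = F1 y) ->
  (forall y, x < y -> y <= b -> F y = F2 y) ->
  mu.-integrable `[a, b] (EFin \o F) /\
  \int[mu]_(y in `[a, b]) F y =
    \int[mu]_(y in `[a, x]) F1 y + \int[mu]_(y in `[x, b]) F2 y.
Proof.
move=> ax xb i1 i2 E1 E2.
have j1 : mu.-integrable `[a, x[ (EFin \o F1).
  by apply: integrableS i1 => //; apply: subset_itvl; rewrite bnd_simp.
have j2 : mu.-integrable `]x, b] (EFin \o F2).
  by apply: integrableS i2 => //; apply: subset_itvr; rewrite bnd_simp.
have k1 : mu.-integrable `[a, x[ (EFin \o F).
  apply: (@eq_integrable _ _ _ mu _ _ (EFin \o F1)) => // y.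
  by rewrite inE/= in_itv/= => /andP[ay yx]; rewrite E1.
have k2 : mu.-integrable `]x, b] (EFin \o F).
  apply: (@eq_integrable _ _ _ mu _ _ (EFin \o F2)) => // y.
  by rewrite inE/= in_itv/= => /andP[ay yx]; rewrite E2.
have k3 : mu.-integrable ([set x] `|` `]x, b]) (EFin \o F).
  by apply: integrable_setU => //; exact: integrable_set1.
have E : `[a, b]%classic = `[a, x[ `|` ([set x] `|` `]x, b]).
  apply/seteqP; split => y /=; rewrite !in_itv/=.
    move=> /andP[ay yb]; have [yx|xy|->] := ltgtP y x; first by left; rewrite ay.
    - by right; right.
    - by right; left.
  move=> [/andP[ay yx]|[->|/andP[xy yb]]].
  - by rewrite ay/= (le_trans (ltW yx)).
  - by rewrite ax.
  - by rewrite yb (le_trans ax) ?ltW.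
have mU : measurable ([set x] `|` `]x, b]) by exact: measurableU.
split; first by rewrite E; exact: integrable_setU.
rewrite E Rintegral_setU//; last 2 first.
- by rewrite -E E; exact: integrable_setU.
- apply/disj_setPS => y [/=]; rewrite in_itv/= => /andP[_ yx] [yE|].
    by rewrite yE ltxx in yx.
  by rewrite in_itv/= => /andP[xy _]; rewrite ltNge (ltW xy) in yx.
rewrite Rintegral_setU//; last first.
  apply/disj_setPS => y [/= ->]; rewrite in_itv/= => /andP[].
  by rewrite ltxx.
rewrite Rintegral_set1 add0r.
rewrite (@eq_Rintegral _ _ _ mu `[a, x[ F1 F); last first.
  by move=> y; rewrite inE/= in_itv/= => /andP[ay yx]; rewrite E1.
rewrite (@eq_Rintegral _ _ _ mu `]x, b] F2 F); last first.
  by move=> y; rewrite inE/= in_itv/= => /andP[ay yx]; rewrite E2.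
by rewrite Rintegral_itv_bndo_bndc// Rintegral_itv_obnd_cbnd.
Qed.

Lemma Rintegral_split a b x F : a <= x -> x <= b ->
  mu.-integrable `[a, b] (EFin \o F) ->
  \int[mu]_(y in `[a, b]) F y =
    \int[mu]_(y in `[a, x]) F y + \int[mu]_(y in `[x, b]) F y.
Proof.
move=> ax xb iF; have [] := @Rintegral_piecewise a b x F F F ax xb => //.
- by apply: integrableS iF => //; apply: subset_itvl; rewrite bnd_simp.
- by apply: integrableS iF => //; apply: subset_itvr; rewrite bnd_simp.
Qed.

End Piecewise.

(** * Coercivity of the inner product *)

Section SobolevSpace.
Context {R : realType}.
Implicit Types (x y : R) (f g u v : R -> R).
Local Notation mu := (@lebesgue_measure R).
Local Notation a := (- (pi / 2) : R).
Local Notation b := (pi / 2 : R).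

Lemma pihalf_itv : a < b.
Proof. by have := @pi_gt0 R; lra. Qed.

Lemma measurable_Delta : measurable (@Delta R).
Proof. exact: measurable_itv. Qed.

Lemma Delta_lty : (mu (@Delta R) < +oo)%E.
Proof.
by rewrite [X in (X < _)%E](lebesgue_measure_itv `[a, b]) /= lte_fin pihalf_itv ltry.
Qed.

Lemma H1P f :
  H1 f <-> abs_continuous_chain a b f /\ square_integrable (@Delta R) (derive1 f).
Proof.
split=> [[acf mf f2]|[acf [mf f2]]].
  by split; [exact: abs_continuous_onW|split].
by split=> //; apply: abs_continuous_chainW => //; exact: ltW pihalf_itv.
Qed.

Lemma H10_AC f : H10 f -> abs_continuous_chain a b f.
Proof. by move=> [/H1P[]]. Qed.

Lemma H10_square_integrable f : H10 f -> square_integrable (@Delta R) (derive1 f).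
Proof. by move=> [/H1P[]]. Qed.

Lemma AC_square_integrable f : abs_continuous_chain a b f ->
  square_integrable (@Delta R) f.
Proof.
move=> acf; have ab := ltW pihalf_itv.
have [M M0 fM] := abs_continuous_chain_le ab acf.
apply: (@bounded_square_integrable _ _ _ M).
- exact: measurable_Delta.
- exact: Delta_lty.
- exact: abs_continuous_measurable.
- by move=> x; rewrite /Delta/= in_itv/= => /andP[? ?]; exact: fM.
Qed.

(** Because of default values, [derive1] is only guaranteed to commute with differences where both
    functions are derivable. *)
Lemma derive1B_ae u v : abs_continuous_chain a b u ->
  abs_continuous_chain a b v ->
  (fun x => derive1 u x - derive1 v x) = derive1 (u \- v)
    %[ae mu in @Delta R].
Proof.
move=> acu acv; have ab := ltW pihalf_itv.
apply: ae_eq_itv_oo_cc; have := abs_continuous_ae_derivable ab acv.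
have := abs_continuous_ae_derivable ab acu.
apply: ae_imp2 => x du dv xab.
by rewrite !derive1E deriveB//; [exact: du|exact: dv].
Qed.

Lemma H10B u v : H10 u -> H10 v -> H10 (u \- v).
Proof.
move=> Hu Hv; have acuv := abs_continuous_chainB (H10_AC Hu) (H10_AC Hv).
split; last by rewrite /= Hu.2 Hv.2.
apply/H1P; split=> //.
apply: (ae_eq_square_integrable measurable_Delta _
  (derive1B_ae (H10_AC Hu) (H10_AC Hv))).
- by apply: abs_continuous_measurable_derive1 => //; exact: ltW pihalf_itv.
- apply: square_integrableB; [exact: measurable_Delta|..];
    exact: H10_square_integrable.
Qed.

Lemma ip_iE f : H10 f -> pi ^+ 2 * ip_i f f =
  2 * intD f ^+ 2 - pi * intD (fun x => f x ^+ 2)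
    + pi * intD (fun x => derive1 f x ^+ 2).
Proof.
move=> Hf; have [_ f2] := AC_square_integrable (H10_AC Hf).
have [_ df2] := H10_square_integrable Hf.
rewrite /ip_i mulVKf; last by rewrite expf_neq0// gt_eqF// pi_gt0.
rewrite (_ : intD (fun x => f x * f x - _) =
  intD (fun x => f x ^+ 2) - intD (fun x => derive1 f x ^+ 2)); first by ring.
by rewrite /intD -RintegralB//; exact: measurable_Delta.
Qed.

(* Having mean zero, it has the least [L_2] norm among the functions [s] with
   [\int f' s = pi f(x) - \int f] for all [f] in the space. *)
Definition sawtooth x y : R := if y <= x then y - x + b else y - x - b.

Lemma Rintegral_mul_affine c d (k : R) f : c <= d ->
  abs_continuous_chain c d f ->
  mu.-integrable `[c, d] (EFin \o (fun y => derive1 f y * (y + k))) /\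
  \int[mu]_(y in `[c, d]) (derive1 f y * (y + k)) =
    f d * (d + k) - f c * (c + k) - \int[mu]_(y in `[c, d]) f y.
Proof.
move=> cd acf.
have acphi : abs_continuous_chain c d (fun y => y + k).
  apply: abs_continuous_onW; apply: (@lipschitz_abs_continuous _ _ _ _ 1).
  by move=> x y _ xy _; rewrite mul1r ger0_norm; lra.
have dphi y : is_derive y (1 : R) (fun y => y + k) (cst 1 y).
  by apply: is_derive_eq; rewrite addr0.
have [i1 E] := abs_continuous_integration_by_parts cd acf acphi dphi
  (fun y => @cst_continuous _ _ (1 : R) y).
split=> //; rewrite E; congr (_ - _).
by apply: eq_Rintegral => y _; rewrite mulr1.
Qed.

(** The sawtooth has slope 1, which gives [- intD f], and drops by [pi] at [x], which gives
    [pi * f x]. The boundary terms [x * f a] and [- x * f b] cancel by periodicity. *)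
Lemma sawtooth_representation f x : H10 f -> Delta x ->
  intD (fun y => derive1 f y * sawtooth x y) = pi * f x - intD f.
Proof.
move=> Hf; rewrite /Delta/= in_itv/= => /andP[ax xb].
have acf := H10_AC Hf; have fab := Hf.2; have ab := ltW pihalf_itv.
have [i1 E1] := @Rintegral_mul_affine a x (- x + b) f ax
  (abs_continuous_chainS (lexx _) xb acf).
have [i2 E2] := @Rintegral_mul_affine x b (- x - b) f xb
  (abs_continuous_chainS ax (lexx _) acf).
have [|y xy yb|_] := @Rintegral_piecewise _ a b x
  (fun y => derive1 f y * sawtooth x y) _ _ ax xb i1 i2.
- by move=> y ay yx; rewrite /sawtooth (ltW yx)/=; ring.
- by rewrite /sawtooth leNgt xy/=; ring.
rewrite /intD /Delta => ->; rewrite E1 E2.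
rewrite (Rintegral_split ax xb (abs_continuous_integrable ab acf)) fab.
by field.
Qed.

Lemma measurable_sawtooth x : measurable_fun setT (sawtooth x).
Proof.
apply: measurable_fun_ifT => //.
- exact: measurable_fun_ler.
- by apply: measurable_funD => //; apply: measurable_funB.
- by apply: measurable_funB => //; apply: measurable_funB.
Qed.

Lemma square_integrable_sawtooth x : square_integrable (@Delta R) (sawtooth x).
Proof.
apply: (@bounded_square_integrable _ _ _ (pi + `|x| + b)).
- exact: measurable_Delta.
- exact: Delta_lty.
- exact: measurable_funTS (measurable_sawtooth x).
- move=> y; rewrite /Delta/= in_itv/= => yab; rewrite ler_norml.
  have := ler_norm x; have := ler_norm (- x); rewrite normrN /sawtooth.
  by have := @pi_gt0 R; case: ifP => _; lra.
Qed.

Lemma Rintegral_affine_sqr c d (k : R) : c <= d ->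
  mu.-integrable `[c, d] (EFin \o (fun y => (y + k) ^+ 2)) /\
  \int[mu]_(y in `[c, d]) ((y + k) ^+ 2) = ((d + k) ^+ 3 - (c + k) ^+ 3) / 3.
Proof.
move=> cd.
have acphi : abs_continuous_chain c d (fun y => y + k).
  apply: abs_continuous_onW; apply: (@lipschitz_abs_continuous _ _ _ _ 1).
  by move=> x y _ xy _; rewrite mul1r ger0_norm; lra.
have dF y : is_derive y (1 : R) (fun y => (y + k) ^+ 3 / 3) ((y + k) ^+ 2).
  by apply: is_derive_eq; rewrite /GRing.scale/=; field.
have acF : abs_continuous_chain c d (fun y => (y + k) ^+ 3 / 3).
  have acc : abs_continuous_chain c d (fun=> 3^-1 : R).
    apply: abs_continuous_onW; apply: (@lipschitz_abs_continuous _ _ _ _ 0).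
    by move=> x y _ _ _; rewrite subrr normr0 mul0r.
  rewrite (_ : (fun y => (y + k) ^+ 3 / 3) =
    (fun y => (y + k) * ((y + k) * (y + k)) * 3^-1)); last first.
    by apply/funext => y; rewrite !exprS expr0; ring.
  exact: abs_continuous_chainM cd (abs_continuous_chainM cd acphi
    (abs_continuous_chainM cd acphi acphi)) acc.
have [i E] := abs_continuous_FTC cd acF.
have dE : derive1 (fun y => (y + k) ^+ 3 / 3) = fun y => (y + k) ^+ 2.
  by apply/funext => y; rewrite derive1E; have [_ ->] := dF y.
rewrite dE in i E; split=> //; rewrite (E d cd (lexx _)).
by field.
Qed.

(** The value is independent of [x] since varying [x] translates one [pi]-periodic function; it is
    the integral of [t^2] over [Delta]. *)
Lemma intD_sawtooth_sqr x : Delta x ->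
  intD (fun y => sawtooth x y ^+ 2) = pi ^+ 3 / 12.
Proof.
rewrite /Delta/= in_itv/= => /andP[ax xb].
have [i1 E1] := @Rintegral_affine_sqr a x (- x + b) ax.
have [i2 E2] := @Rintegral_affine_sqr x b (- x - b) xb.
have [|y xy yb|_] := @Rintegral_piecewise _ a b x
  (fun y => sawtooth x y ^+ 2) _ _ ax xb i1 i2.
- by move=> y ay yx; rewrite /sawtooth (ltW yx)/= addrA.
- by rewrite /sawtooth leNgt xy/= addrA.
by rewrite /intD /Delta => ->; rewrite E1 E2; field.
Qed.

Lemma H10_pointwise_bound f x : H10 f -> Delta x ->
  (pi * f x - intD f) ^+ 2 <= pi ^+ 3 / 12 * intD (fun y => derive1 f y ^+ 2).
Proof.
move=> Hf Dx; rewrite -sawtooth_representation// -(intD_sawtooth_sqr Dx) mulrC.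
apply: Cauchy_Schwarz_integral.
- exact: measurable_Delta.
- exact: H10_square_integrable.
- exact: square_integrable_sawtooth.
- by have := intD_sawtooth_sqr Dx; rewrite /intD => ->;
    rewrite divr_gt0// exprn_gt0// pi_gt0.
Qed.

Lemma intD_cst (k : R) : intD (fun=> k) = k * pi.
Proof.
rewrite /intD Rintegral_cst; last exact: measurable_Delta.
rewrite [X in fine X](lebesgue_measure_itv `[a, b])/= lte_fin pihalf_itv/=.
by congr (_ * _); field.
Qed.

Lemma ip_i_coercive f : H10 f ->
  intD f ^+ 2 + pi * (1 - pi ^+ 2 / 12) * intD (fun y => derive1 f y ^+ 2)
    <= pi ^+ 2 * ip_i f f.
Proof.
move=> Hf; rewrite ip_iE//.
have acf := H10_AC Hf; have ab := ltW pihalf_itv.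
have if1 := abs_continuous_integrable ab acf.
have [_ if2] := AC_square_integrable acf.
set I := intD f; set D := intD (fun y => derive1 f y ^+ 2).
set F := intD (fun x => f x ^+ 2).
have mD := measurable_Delta; have Doo := Delta_lty.
have ic (k : R) : mu.-integrable (@Delta R) (EFin \o (fun=> k)).
  exact: integrable_cst.
have H : intD (fun x => (pi * f x - I) ^+ 2) <= intD (fun=> pi ^+ 3 / 12 * D).
  apply: le_Rintegral => //.
    apply: (square_integrableB mD (square_integrableZ pi mD
      (AC_square_integrable acf)) _).2.
    by apply: (@bounded_square_integrable _ _ _ `|I|).
  by move=> x Dx; exact: H10_pointwise_bound.
have i1 := integrable_fun_scale (pi ^+ 2) mD if2.
have i2 := integrable_fun_scale (2 * pi * I) mD if1.
have E : intD (fun x => (pi * f x - I) ^+ 2) = pi ^+ 2 * F - pi * I ^+ 2.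
  transitivity (intD (fun x => pi ^+ 2 * f x ^+ 2 - 2 * pi * I * f x + I ^+ 2)).
    by apply: eq_Rintegral => x _; ring.
  rewrite /intD RintegralD//; last exact: integrable_fun_sub.
  rewrite RintegralB// !RintegralZl//.
  transitivity (pi ^+ 2 * F - 2 * pi * I * I + I * (I * pi)); last by ring.
  congr (_ * _ - _ * _ + _ * _); exact: intD_cst.
rewrite E intD_cst in H.
have p0 := @pi_gt0 R.
(* [- pi * F] is the only negative term of [ip_iE]. Absorbing it costs one of the two copies of
   [I ^+ 2] and the fraction [pi ^+ 2 / 12] of [pi * D]. *)
have : pi * F <= I ^+ 2 + pi ^+ 3 / 12 * D.
  rewrite -(ler_pM2l p0); move: H; rewrite !exprS expr0; lra.
rewrite !exprS expr0; lra.
Qed.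

Lemma intD_sqr_ge0 f : 0 <= intD (fun y => f y ^+ 2).
Proof. by apply: Rintegral_ge0 => x _; exact: sqr_ge0. Qed.

Lemma coercivity_gt0 : 0 < 1 - (pi : R) ^+ 2 / 12.
Proof. by have := @pi_sqr_lt12 R; lra. Qed.

(** [Num.sqrt] is 0 on negative numbers, so the content is that [ip_i f f] is nonnegative, a
    consequence of coercivity. *)
Lemma norm_i_sqr f : H10 f -> norm_i f ^+ 2 = ip_i f f.
Proof.
move=> Hf; rewrite sqr_sqrtr//.
have p2 : 0 < (pi : R) ^+ 2 by rewrite exprn_gt0// pi_gt0.
rewrite -(pmulr_rge0 _ p2); apply: le_trans (ip_i_coercive Hf).
rewrite addr_ge0 ?sqr_ge0// !mulr_ge0 ?pi_ge0 ?intD_sqr_ge0//.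
exact: ltW coercivity_gt0.
Qed.

Lemma norm_i_derive_bound : exists2 C : R, 0 < C & forall f, H10 f ->
  intD (fun y => derive1 f y ^+ 2) <= C * norm_i f ^+ 2.
Proof.
have c0 : 0 < pi * (1 - (pi : R) ^+ 2 / 12) by rewrite mulr_gt0 ?pi_gt0 ?coercivity_gt0.
exists (pi ^+ 2 / (pi * (1 - (pi : R) ^+ 2 / 12))).
  by rewrite divr_gt0// exprn_gt0// pi_gt0.
move=> f Hf; rewrite norm_i_sqr// mulrAC ler_pdivlMr// mulrC.
by apply: le_trans (ip_i_coercive Hf); rewrite lerDr sqr_ge0.
Qed.

Lemma normr_le_sqr (z w : R) : 0 <= w -> z ^+ 2 <= w ^+ 2 -> `|z| <= w.
Proof.
by move=> w0 zw; rewrite -ler_sqr ?nnegrE// real_normK// num_real.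
Qed.

Lemma norm_i_eval_bound x : Delta x -> exists C : R, forall f, H10 f ->
  `|f x| <= C * norm_i f.
Proof.
move=> Dx; have [C C0 HC] := norm_i_derive_bound.
have p0 := @pi_gt0 R.
(* [pi * f x] is split into [pi * f x - intD f], which accounts for the square root, and [intD f],
   which accounts for the 1. *)
exists (1 + Num.sqrt (pi ^+ 3 / 12 * C) / pi) => f Hf.
have n0 : 0 <= norm_i f by exact: sqrtr_ge0.
have I1 : `|intD f| <= pi * norm_i f.
  apply: normr_le_sqr; first by rewrite mulr_ge0// ltW.
  rewrite exprMn norm_i_sqr//.
  apply: le_trans (ip_i_coercive Hf); rewrite lerDl !mulr_ge0 ?intD_sqr_ge0 ?ltW//.
  exact: coercivity_gt0.
have P : `|pi * f x - intD f| <= Num.sqrt (pi ^+ 3 / 12 * C) * norm_i f.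
  have c3 : 0 <= (pi : R) ^+ 3 / 12 by rewrite divr_ge0// exprn_ge0// ltW.
  apply: normr_le_sqr; first by rewrite mulr_ge0// sqrtr_ge0.
  rewrite exprMn sqr_sqrtr; last by rewrite mulr_ge0// ltW.
  apply: le_trans (H10_pointwise_bound Hf Dx) _.
  by rewrite -[leRHS]mulrA ler_wpM2l// HC.
rewrite -(ler_pM2l p0) -{1}(gtr0_norm p0) -normrM.
have := ler_normD (pi * f x - intD f) (intD f); rewrite subrK => /le_trans; apply.
apply: le_trans (lerD P I1) _.
set s := Num.sqrt _.
have E (p q r : R) : 0 < p -> p * ((1 + q / p) * r) = q * r + p * r.
  by move=> p_gt0; field; rewrite gt_eqF.
by rewrite E.
Qed.

End SobolevSpace.
(** * Completeness *)

Section Completeness.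
Context {R : realType}.
Implicit Types (x y : R) (f g u v w : R -> R).
Local Notation mu := (@lebesgue_measure R).
Local Notation a := (- (pi / 2) : R).
Local Notation b := (pi / 2 : R).

Lemma intD_derive1B_sqr u v : H10 u -> H10 v ->
  intD (fun x => derive1 (u \- v) x ^+ 2) =
  intD (fun x => (derive1 u x - derive1 v x) ^+ 2).
Proof.
move=> Hu Hv; apply/esym; apply: ae_eq_Rintegral.
- exact: measurable_Delta.
- by apply: measurable_funX; apply: measurable_funB;
    [exact: (H10_square_integrable Hu).1|exact: (H10_square_integrable Hv).1].
- by apply: measurable_funX; exact: (H10_square_integrable (H10B Hu Hv)).1.
- apply: ae_imp (derive1B_ae (H10_AC Hu) (H10_AC Hv)) => x H Dx.
  by rewrite -H.
Qed.

Lemma intD_sqr_le f : square_integrable (@Delta R) f ->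
  (intD (fun x => `|f x|)) ^+ 2 <= pi * intD (fun x => f x ^+ 2).
Proof.
move=> Df; have mD := @measurable_Delta R; have Doo := @Delta_lty R.
have D1 : square_integrable (@Delta R) (fun=> 1).
  by apply: (@bounded_square_integrable _ _ _ 1) => // x _; rewrite normr1.
have Dn : square_integrable (@Delta R) (fun x => `|f x|).
  split; first by apply: measurableT_comp => //; exact: Df.1.
  apply: (@eq_integrable _ _ _ mu _ _ (EFin \o (fun x => f x ^+ 2))) => //.
    by move=> x _; rewrite /= real_normK// num_real.
  exact: Df.2.
have E1 : \int[mu]_(x in @Delta R) (1 ^+ 2) = pi :> R.
  by have := @intD_cst R 1; rewrite mul1r /intD expr1n.
have := Cauchy_Schwarz_integral mD Dn D1; rewrite E1 => /(_ (pi_gt0 R)).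
rewrite mulrC => H.
have -> : intD (fun x => `|f x|) = \int[mu]_(x in @Delta R) (`|f x| * 1).
  by apply: eq_Rintegral => x _; rewrite mulr1.
apply: le_trans H _; rewrite ler_pM2l ?pi_gt0//.
rewrite le_eqVlt; apply/orP; left; apply/eqP.
by apply: eq_Rintegral => x _; rewrite real_normK// num_real.
Qed.

(** No periodicity is assumed, so that this applies to [u n \- f] while [f a = f b] is still to be
    proved for the limit [f]. *)
Lemma AC_oscillation w x : abs_continuous_chain a b w ->
  square_integrable (@Delta R) (derive1 w) -> Delta x ->
  (w x - w a) ^+ 2 <= pi * intD (fun y => derive1 w y ^+ 2).
Proof.
move=> acw Dw; rewrite /Delta/= in_itv/= => /andP[ax xb].
have ab := ltW (@pihalf_itv R).
have [iw E] := abs_continuous_FTC ab acw.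
rewrite -E//; apply: le_trans (intD_sqr_le Dw).
have sub : `[a, x] `<=` `[a, b] by apply: subset_itvl; rewrite bnd_simp.
have iwx : mu.-integrable `[a, x] (EFin \o derive1 w) by exact: integrableS iw.
rewrite -(real_normK (num_real (\int[mu]_(t in _) _))) ler_sqr ?nnegrE//; last first.
  by apply: Rintegral_ge0 => y _; exact: normr_ge0.
apply: (@le_trans _ _ (\int[mu]_(t in `[a, x]) `|derive1 w t|)).
  exact: le_normr_Rintegral.
rewrite /intD /Delta (Rintegral_split ax xb (integrable_norm iw)) lerDl.
by apply: Rintegral_ge0 => y _; exact: normr_ge0.
Qed.

(** A converse to coercivity: convergence at one endpoint together with [L_2] convergence of
    derivatives gives convergence in norm. *)
Lemma ip_i_le w : H10 w -> ip_i w w <=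
  4 * w a ^+ 2 + (4 * pi + 1) * intD (fun y => derive1 w y ^+ 2).
Proof.
move=> Hw; have acw := H10_AC Hw; have Dw := H10_square_integrable Hw.
have mD := @measurable_Delta R; have Doo := @Delta_lty R.
have p2 := @pi_ge2 R; have p0 := @pi_gt0 R.
set d := intD (fun y => _).
have d0 : 0 <= d by exact: intD_sqr_ge0.
have DW := AC_square_integrable acw.
have w2 x : Delta x -> w x ^+ 2 <= 2 * w a ^+ 2 + 2 * (pi * d).
  move=> Dx; have := AC_oscillation acw Dw Dx; rewrite -/d.
  have := sqr_ge0 (w x - w a - w a); rewrite !expr2; lra.
have W : intD (fun x => w x ^+ 2) <= (2 * w a ^+ 2 + 2 * (pi * d)) * pi.
  rewrite -intD_cst; apply: le_Rintegral => //; first exact: DW.2.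
  exact: integrable_cst.
have I2 : intD w ^+ 2 <= pi * intD (fun x => w x ^+ 2).
  apply: le_trans (intD_sqr_le DW).
  rewrite -(real_normK (num_real (intD w))) ler_sqr ?nnegrE//; last first.
    by apply: Rintegral_ge0 => y _; exact: normr_ge0.
  apply: le_normr_Rintegral => //.
  exact: abs_continuous_integrable (ltW (@pihalf_itv R)) acw.
have W0 := intD_sqr_ge0 w.
have : pi ^+ 2 * ip_i w w <= pi ^+ 2 * (4 * w a ^+ 2 + (4 * pi + 1) * d).
  rewrite ip_iE// -/d.
  have J : pi * intD (fun x => w x ^+ 2) <= pi * ((2 * w a ^+ 2 + 2 * (pi * d)) * pi).
    by rewrite ler_pM2l.
  have K : pi * d <= pi * (pi * d).
    by rewrite ler_pM2l// ler_peMl//; lra.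
  have L : 0 <= pi * intD (fun x => w x ^+ 2) by rewrite mulr_ge0// ltW.
  move: I2 J K L; set I := intD w ^+ 2; set W' := intD _; set A := w a ^+ 2.
  rewrite !expr2; lra.
by rewrite ler_pM2l// exprn_gt0.
Qed.

Lemma square_integrable_integrable f : square_integrable (@Delta R) f ->
  mu.-integrable (@Delta R) (EFin \o f).
Proof.
move=> Df; have mD := @measurable_Delta R.
have D1 : square_integrable (@Delta R) (fun=> 1).
  apply: (@bounded_square_integrable _ _ _ 1) => //; first exact: Delta_lty.
  by move=> x _; rewrite normr1.
apply: (@eq_integrable _ _ _ mu _ _ (EFin \o (fun x => f x * 1))) => //.
  by move=> x _; rewrite /= mulr1.
exact: square_integrableM.
Qed.

Lemma H1_primitive c G : square_integrable (@Delta R) G ->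
  exists2 f, H1 f & f a = c /\ derive1 f = G %[ae mu in @Delta R].
Proof.
move=> DG; have ab := ltW (@pihalf_itv R); have mD := @measurable_Delta R.
(* Extension by zero gives a density integrable on the whole line, as the lemmas on primitives
   expect. *)
pose g := G \_ (@Delta R).
have ig : mu.-integrable setT (EFin \o g).
  have := (@integrable_mkcond _ _ R mu _ (EFin \o G) mD).1
    (square_integrable_integrable DG).
  by rewrite restrict_EFin.
pose f x := c + \int[mu]_(t in `]a, x]) g t.
have fa : f a = c.
  by rewrite /f set_itv_ge ?Rintegral_set0 ?addr0// bnd_simp ltxx.
have fE x : a <= x -> x <= b -> f x - f a = \int[mu]_(t in `]a, x]) g t.
  by move=> _ _; rewrite fa /f addrAC subrr add0r.
have acf := abs_continuous_primitive ig fE.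
have fG : derive1 f = G %[ae mu in @Delta R].
  apply: ae_eq_itv_oo_cc; have := integral_ae_derivable ig fE.
  apply: ae_imp => x H xab; have [_ ->] := H xab.
  rewrite /g patchE mem_set// /Delta/= in_itv/=.
  by move: xab => /andP[/ltW -> /ltW ->].
exists f => //; apply/H1P; split=> //.
apply: (@ae_eq_square_integrable _ _ G) => //.
- exact: abs_continuous_measurable_derive1.
- by apply: ae_imp fG => x H Dx; rewrite H.
Qed.

Lemma square_le_all_eq0 (z k : R) : 0 < k ->
  (forall e, 0 < e -> z ^+ 2 <= k * e) -> z = 0.
Proof.
move=> k0 H; apply/eqP; rewrite -sqrf_eq0 eq_le sqr_ge0 andbT.
apply/ler_addgt0Pr => e e0; rewrite add0r.
by have := H (e / k) (divr_gt0 e0 k0); rewrite mulrCA divff ?mulr1// gt_eqF.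
Qed.

Theorem H10_complete (u : nat -> R -> R) : (forall n, H10 (u n)) ->
  (forall eps : R, 0 < eps -> exists N : nat, forall m n : nat,
     (N <= m)%N -> (N <= n)%N -> norm_i (u m \- u n) < eps) ->
  exists2 f : R -> R, H10 f & (fun n => norm_i (u n \- f)) @ \oo --> (0 : R).
Proof.
move=> Hu cu; have mD := @measurable_Delta R; have ab := ltW (@pihalf_itv R).
have p0 := @pi_gt0 R.
have Da : Delta a by rewrite /Delta/= in_itv/= lexx.
have Db : Delta b by rewrite /Delta/= in_itv/= lexx andbT.
have [C C0 HC] := @norm_i_derive_bound R.
have [C' HC'] := norm_i_eval_bound Da.
have cg (e : R) : 0 < e -> exists N, forall m n, (N <= m)%N -> (N <= n)%N ->
    \int[mu]_(x in @Delta R) ((derive1 (u m) x - derive1 (u n) x) ^+ 2) <= e.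
  move=> e0; have eC : 0 < Num.sqrt (e / C) by rewrite sqrtr_gt0 divr_gt0.
  have [N NP] := cu _ eC; exists N => m n Nm Nn.
  have := HC _ (H10B (Hu m) (Hu n)); rewrite intD_derive1B_sqr//.
  move=> /le_trans; apply; rewrite -ler_pdivlMl// mulrC.
  rewrite -[leRHS]sqr_sqrtr; last by rewrite divr_ge0 ?ltW.
  by rewrite ler_sqr ?nnegrE ?sqrtr_ge0// ltW// NP.
have [G DG GP] := square_integrable_complete mD (@Delta_lty R)
  (fun n => H10_square_integrable (Hu n)) cg.
have /cvg_ex[/= c cP] : cvgn (fun n => u n a : R).
  apply/cauchy_cvgP/cauchy_exP => e e0.
  have C1 : 0 < `|C'| + 1 by rewrite ltr_wpDl.
  have [N NP] := cu _ (divr_gt0 e0 C1); exists (u N a).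
  exists N => // n /= Nn; rewrite /ball/=.
  have := NP _ _ (leqnn N) Nn; rewrite ltr_pdivlMr//.
  apply: le_lt_trans; apply: le_trans (HC' _ (H10B (Hu N) (Hu n))) _.
  rewrite mulrC ler_wpM2l ?sqrtr_ge0//.
  by apply: le_trans (ler_norm _) _; rewrite lerDl.
(* The candidate limit is the primitive of the [L_2] limit of the derivatives, starting from the
   limit [c] of the values at the left endpoint. *)
have [f Hf [fa fG]] := H1_primitive c DG.
have [acf Df] := (H1P f).1 Hf.
have intE n : intD (fun x => derive1 (u n \- f) x ^+ 2) =
    \int[mu]_(x in @Delta R) ((derive1 (u n) x - G x) ^+ 2).
  apply: ae_eq_Rintegral => //.
  - apply: measurable_funX; apply: abs_continuous_measurable_derive1 => //.
    exact: abs_continuous_chainB (H10_AC (Hu n)) acf.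
  - by apply: measurable_funX; apply: measurable_funB;
      [exact: (H10_square_integrable (Hu n)).1|exact: DG.1].
  - apply: ae_imp2 (derive1B_ae (H10_AC (Hu n)) acf) fG => x H1 H2 Dx.
    by rewrite -H1// H2.
(* The primitive is not periodic by construction. As [u N] is periodic, [f b - f a] is up to sign
   the oscillation of [u N \- f], hence bounded by the [L_2] distance of the derivatives. *)
have fab : f a = f b.
  suff : f b - f a = 0 by lra.
  apply: (@square_le_all_eq0 _ pi) => // e e0; have [N NP] := GP _ e0.
  have acw := abs_continuous_chainB (H10_AC (Hu N)) acf.
  have Dw : square_integrable (@Delta R) (derive1 (u N \- f)).
    apply: (ae_eq_square_integrable mD _ (derive1B_ae (H10_AC (Hu N)) acf)).
    - exact: abs_continuous_measurable_derive1.
    - by apply: square_integrableB => //; exact: H10_square_integrable.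
  have := AC_oscillation acw Dw Db; rewrite (Hu N).2.
  rewrite (_ : _ - _ - _ = - (f b - f a)); last by ring.
  rewrite sqrrN => /le_trans; apply; rewrite ler_pM2l//.
  by rewrite -/(u N \- f) intE; exact: NP.
have H10f : H10 f by [].
exists f => //; apply/cvgr0Pnorm_lt => e e0.
have k0 : 0 < 4 * pi + 1 :> R by lra.
(* With [e1], and [e / 4] at the endpoint, each term of [ip_i_le] is at most [e ^+ 2 / 4]. *)
have e1 : 0 < e ^+ 2 / 4 / (4 * pi + 1) by rewrite !divr_gt0// exprn_gt0.
have [N NP] := GP _ e1.
have e4 : 0 < e / 4 by lra.
near=> n.
have un : `|c - u n a| < e / 4.
  by near: n; move/cvgrPdist_lt : cP; apply.
have Nn : (N <= n)%N by near: n; exact: nbhs_infty_ge.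
have Hw := H10B (Hu n) H10f.
rewrite ger0_norm ?sqrtr_ge0//.
rewrite -ltr_sqr ?nnegrE ?sqrtr_ge0//; last exact: ltW.
rewrite norm_i_sqr//; apply: le_lt_trans (ip_i_le Hw) _.
have := NP _ Nn; rewrite -intE ler_pdivlMr// mulrC => P1.
have P2 : (u n \- f) a ^+ 2 < (e / 4) ^+ 2.
  rewrite /= fa -(real_normK (num_real (_ - _))) distrC.
  by rewrite ltr_sqr ?nnegrE// ltW.
have e2 : 0 < e ^+ 2 by rewrite exprn_gt0.
have -> : e ^+ 2 = 4 * (e / 4) ^+ 2 + 3 * (e ^+ 2 / 4) by field.
lra.
Unshelve. all: by end_near. Qed.

End Completeness.
(** * The reproducing kernel *)

Section Kernel.
Context {R : realType}.
Implicit Types (x y z c d k : R) (f : R -> R).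
Local Notation mu := (@lebesgue_measure R).
Local Notation a := (- (pi / 2) : R).
Local Notation b := (pi / 2 : R).

Lemma sin_lipschitz y z : `|sin y - sin z| <= `|y - z|.
Proof.
wlog yz : y z / z <= y.
  move=> W; have [/W//|/ltW/W] := leP z y.
  by rewrite distrC (distrC z).
have csin : {within `[z, y], continuous (@sin R)}.
  by apply: continuous_subspaceT; exact: continuous_sin.
have [c _ ->] := MVT_segment yz (fun x _ => is_derive_sin x) csin.
by rewrite normrM ler_piMl// ler_norml cos_geN1 cos_le1.
Qed.

Lemma K_i_AC x : abs_continuous_chain a b (K_i x).
Proof.
apply: abs_continuous_onW; apply: (@lipschitz_abs_continuous _ _ _ _ (pi / 2)).
move=> y z _ yz _; rewrite /K_i.
rewrite (_ : _ - _ - _ = pi / 2 * (sin `|x - y| - sin `|x - z|)); last by ring.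
rewrite normrM ger0_norm; last by rewrite divr_ge0// pi_ge0.
rewrite ler_wpM2l//; first by rewrite divr_ge0// pi_ge0.
apply: le_trans (sin_lipschitz _ _) _; apply: le_trans (ler_dist_dist _ _) _.
by rewrite (_ : _ - _ - _ = z - y) ?ger0_norm ?subr_ge0//; ring.
Qed.

Lemma K_i_pihalf x : Delta x -> K_i x a = K_i x b.
Proof.
rewrite /Delta/= in_itv/= => /andP[ax xb]; rewrite /K_i.
rewrite ger0_norm; last by lra.
rewrite ler0_norm; last by lra.
by rewrite opprK opprB sinDpihalf -[b - x]opprB sinN sinBpihalf opprK.
Qed.

Lemma derive1_K_i_lt x y : y < x -> derive1 (K_i x) y = pi / 2 * cos (x - y).
Proof.
move=> yx; rewrite (@near_eq_derive1 _ _ (fun z => 2 - pi / 2 * sin (x - z))).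
  rewrite derive1E; apply: derive_val.
  by apply: is_derive_eq; rewrite /GRing.scale/=; ring.
have y1 : y - 1 < y by lra.
by apply: (near_itv_oo y1 yx) => z _ zx; rewrite /K_i ger0_norm ?subr_ge0 ?ltW.
Qed.

Lemma derive1_K_i_gt x y : x < y -> derive1 (K_i x) y = - (pi / 2) * cos (x - y).
Proof.
move=> xy; rewrite (@near_eq_derive1 _ _ (fun z => 2 + pi / 2 * sin (x - z))).
  rewrite derive1E; apply: derive_val.
  by apply: is_derive_eq; rewrite /GRing.scale/=; ring.
have y1 : y < y + 1 by lra.
apply: (near_itv_oo xy y1) => z xz _; rewrite /K_i ler0_norm ?subr_le0 ?ltW//.
by rewrite sinN; ring.
Qed.

Lemma continuous_integrable c d f : continuous f ->
  mu.-integrable `[c, d] (EFin \o f).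
Proof.
move=> cf; apply: continuous_compact_integrable; first exact: segment_compact.
exact: continuous_subspaceT.
Qed.

Lemma is_derive_cosB x k y :
  is_derive y (1 : R) (fun z => k * cos (x - z)) (k * sin (x - y)).
Proof. by apply: is_derive_eq; rewrite /GRing.scale/=; ring. Qed.

Lemma is_derive_sinB x k y :
  is_derive y (1 : R) (fun z => k * sin (x - z)) (- k * cos (x - y)).
Proof. by apply: is_derive_eq; rewrite /GRing.scale/=; ring. Qed.

Lemma is_derive_continuous f (df : R -> R) :
  (forall y, is_derive y (1 : R) f (df y)) -> continuous f.
Proof.
move=> dfE y; apply: differentiable_continuous; apply/derivable1_diffP.
by have [] := dfE y.
Qed.

Lemma K_i_H10 x : Delta x -> H10 (K_i x).
Proof.
move=> Dx; split; last exact: K_i_pihalf.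
apply/H1P; split; first exact: K_i_AC.
split; first exact: abs_continuous_measurable_derive1 (ltW pihalf_itv) (K_i_AC x).
move: Dx; rewrite /Delta/= in_itv/= => /andP[ax xb].
have cc k : continuous (fun y => (k * cos (x - y)) ^+ 2).
  have ck := is_derive_continuous (is_derive_cosB x k).
  by move=> y; apply: cvgM; exact: ck.
have [|y xy yb|//] := @Rintegral_piecewise _ a b x (fun y => derive1 (K_i x) y ^+ 2)
  _ _ ax xb (continuous_integrable a x (cc (pi / 2)))
  (continuous_integrable x b (cc (- (pi / 2)))).
- by move=> y ay yx; rewrite derive1_K_i_lt.
- by rewrite derive1_K_i_gt.
Qed.

(** On each side of [x] the kernel is [K = 2 - k sin(x - y)] with [k = pi / 2] or [- (pi / 2)], and
    solves [K'' + K = 2]. Integrating [f' K'] by parts thus leaves only [2 \int f] and boundary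
    terms. *)
Lemma Rintegral_kernel_by_parts c d k x f : c <= d ->
  abs_continuous_chain c d f ->
  mu.-integrable `[c, d] (EFin \o (fun y =>
    f y * (2 - k * sin (x - y)) - derive1 f y * (k * cos (x - y)))) /\
  \int[mu]_(y in `[c, d])
    (f y * (2 - k * sin (x - y)) - derive1 f y * (k * cos (x - y))) =
  2 * \int[mu]_(y in `[c, d]) f y
    - (f d * (k * cos (x - d)) - f c * (k * cos (x - c))).
Proof.
move=> cd acf.
have acl M (phi : R -> R) : (forall y z, `|phi y - phi z| <= M * `|y - z|) ->
    abs_continuous_chain c d phi.
  move=> lip; apply: abs_continuous_onW; apply: (@lipschitz_abs_continuous _ _ _ _ M).
  by move=> y z _ yz _; rewrite -(@ger0_norm _ (z - y)) ?subr_ge0.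
have accos : abs_continuous_chain c d (fun y => k * cos (x - y)).
  apply: (acl `|k|) => y z; rewrite -mulrBr normrM ler_wpM2l//.
  rewrite -!sinDpihalf; apply: le_trans (sin_lipschitz _ _) _.
  by rewrite (_ : _ - _ = z - y) ?(distrC z)//; ring.
have acsin : abs_continuous_chain c d (fun y => k * sin (x - y)).
  apply: (acl `|k|) => y z; rewrite -mulrBr normrM ler_wpM2l//.
  apply: le_trans (sin_lipschitz _ _) _.
  by rewrite (_ : _ - _ = z - y) ?(distrC z)//; ring.
have [i1 E] := abs_continuous_integration_by_parts cd acf accos
  (is_derive_cosB x k) (is_derive_continuous (is_derive_sinB x k)).
have mcd : measurable `[c, d]%classic by exact: measurable_itv.
have i0 := abs_continuous_integrable cd acf.
have i2 := integrable_mul_abs_continuous cd acsin i0.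
have i3 := integrable_fun_scale 2 mcd i0.
have i4 := integrable_fun_sub mcd i3 i2.
have EF : (fun y => f y * (2 - k * sin (x - y)) - derive1 f y * (k * cos (x - y))) =
    (fun y => 2 * f y - f y * (k * sin (x - y)) - derive1 f y * (k * cos (x - y))).
  by apply/funext => y; ring.
rewrite EF; split; first exact: integrable_fun_sub.
rewrite RintegralB// RintegralB// RintegralZl// E.
by ring.
Qed.

(** The one-sided formulas for the derivative of the kernel agree at the two ends of [Delta], both
    giving [- (pi / 2) * sin x], so the outer boundary terms cancel when [f a = f b]. *)
Lemma K_i_pairing f x : Delta x -> abs_continuous_chain a b f -> f a = f b ->
  intD (fun y => f y * K_i x y - derive1 f y * derive1 (K_i x) y) =
  2 * intD f - pi * f x.
Proof.
rewrite /Delta/= in_itv/= => /andP[ax xb] acf fab.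
have [i1 E1] := @Rintegral_kernel_by_parts a x (pi / 2) x f ax
  (abs_continuous_chainS (lexx _) xb acf).
have [i2 E2] := @Rintegral_kernel_by_parts x b (- (pi / 2)) x f xb
  (abs_continuous_chainS ax (lexx _) acf).
have [|y xy yb|_] := @Rintegral_piecewise _ a b x
  (fun y => f y * K_i x y - derive1 f y * derive1 (K_i x) y) _ _ ax xb i1 i2.
- move=> y ay yx; rewrite derive1_K_i_lt// /K_i ger0_norm//.
  by rewrite subr_ge0 ltW.
- rewrite derive1_K_i_gt// /K_i ler0_norm ?subr_le0 ?ltW//.
  by rewrite sinN; ring.
rewrite /intD /Delta => ->; rewrite E1 E2.
rewrite (Rintegral_split ax xb (abs_continuous_integrable (ltW pihalf_itv) acf)) fab.
by rewrite subrr cos0 opprK cosDpihalf cosBpihalf; field.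
Qed.

(** Pairing the kernel with the constant 1 gives [2 * pi - pi], which replaces a direct
    integration. *)
Lemma intD_K_i x : Delta x -> intD (K_i x) = pi.
Proof.
move=> Dx.
have ac1 : abs_continuous_chain a b (cst 1 : R -> R).
  apply: abs_continuous_onW; apply: (@lipschitz_abs_continuous _ _ _ _ 0).
  by move=> y z _ _ _; rewrite subrr normr0 mul0r.
have := K_i_pairing Dx ac1 erefl; rewrite intD_cst mul1r mulr1.
rewrite (_ : (fun y => _) = K_i x); first by move=> ->; ring.
by apply/funext => y; rewrite derive1_cst /=; ring.
Qed.

Lemma K_i_reproducing f x : Delta x -> H10 f -> ip_i f (K_i x) = f x.
Proof.
move=> Dx Hf; rewrite /ip_i intD_K_i// K_i_pairing//; last 2 first.
- exact: H10_AC.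
- exact: Hf.2.
have p0 := @pi_gt0 R.
(* Since the kernel has integral [pi], both occurrences of [2 * pi * intD f] cancel. *)
rewrite (_ : 2 * _ - _ = pi ^+ 2 * f x); last by ring.
by rewrite mulKf// expf_neq0// gt_eqF.
Qed.

End Kernel.

Theorem theorem3p4 (R : realType) :
  (* completeness *)
  (forall u : nat -> R -> R,
     (forall n, H10 (u n)) ->
     (forall eps : R, 0 < eps -> exists N : nat, forall m n : nat,
        (N <= m)%N -> (N <= n)%N -> norm_i (u m \- u n) < eps) ->
     exists2 f : R -> R, H10 f &
       (fun n => norm_i (u n \- f)) @ \oo --> (0 : R)) /\
  (* point evaluations (linear by definition) are bounded functionals *)
  (forall x : R, Delta x ->
     exists C : R, forall f : R -> R, H10 f -> `|f x| <= C * norm_i f) /\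
  (* K_i is the reproducing kernel *)
  (forall x : R, Delta x ->
     H10 (K_i x) /\ forall f : R -> R, H10 f -> ip_i f (K_i x) = f x).
Proof.
split; first exact: H10_complete.
split; first exact: norm_i_eval_bound.
move=> x Dx; split; first exact: K_i_H10.
by move=> f Hf; exact: K_i_reproducing.
Qed.
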